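(* Let $\lambda\in\mathbf{k}$ and let $A=\bigcup_{n\ge0}A_n$ be a connected filtered bialgebra over $\mathbf{k}$ with a filtered basis $X$. Then $F_{-\lambda^2}(A)$, with the bialgebra structure $(\diamond,1,\Delta_M,\varepsilon_M)$ described in the context, is also a connected filtered bialgebra, and hence a Hopf algebra.
   Context: $\mathbf{k}$ is a commutative unitary ring; all algebras are associative unitary $\mathbf{k}$-algebras, algebra homomorphisms are unital, and $\otimes=\otimes_{\mathbf{k}}$. Filtered bialgebras. A bialgebra $(A,m,\mu,\Delta,\varepsilon)$ (with unit map $\mu:\mathbf{k}\to A$) is filtered if it has an increasing filtration $A_n$, $n\ge0$, with $A=\bigcup_{n\ge0}A_n$, $A_pA_q\subseteq A_{p+q}$ and $\Delta(A_n)\subseteq\sum_{p+q=n}A_p\otimes A_q$ for $p,q,n\ge0$. It is connected if $A_0=\mathrm{im}\,\mu$ and $A=A_0\oplus\ker\varepsilon$. A $\mathbf{k}$-basis $X$ of a connected filtered bialgebra $A=\bigcup_{n\ge0}A_n$ is a filtered basis if there is an increasing filtration $X=\bigcup_{n\ge0}X_n$ with $A_n=\mathbf{k}X_n$ (the span of $X_n$), $X\setminus\{1\}\subseteq\ker\varepsilon$ and $X_0=\{1\}$, where $1$ is the identity of $A$. Modified Rota-Baxter algebras. For $\kappa\in\mathbf{k}$, a modified Rota-Baxter operator of weight $\kappa$ on an algebra $R$ is a linear map $P:R\to R$ with $P(u)P(v)=P(uP(v))+P(P(u)v)+\kappa uv$ for all $u,v\in R$; then $(R,P)$ is a modified Rota-Baxter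 algebra of weight $\kappa$. Morphisms are algebra homomorphisms commuting with the operators. A free modified Rota-Baxter algebra of weight $\kappa$ on an algebra $A$ is a modified Rota-Baxter algebra $(F(A),P_A)$ of weight $\kappa$ with an algebra homomorphism $j:A\to F(A)$ such that for every modified Rota-Baxter algebra $(R,P)$ of weight $\kappa$ and every algebra homomorphism $f:A\to R$ there is a unique morphism of modified Rota-Baxter algebras $\bar f:F(A)\to R$ with $\bar f\circ j=f$. Construction of $F_\kappa(A)$. Let $A$ be an algebra with product $\cdot$ and a $\mathbf{k}$-basis $X$ with $1=1_A\in X$; put $X^+=X\setminus\{1\}$. Let $\lfloor,\rfloor$ be two symbols not in $X$, and $M$ the free monoid on $X^+\cup\{\lfloor,\rfloor\}$, whose empty word is identified with $1$. For $Y,Z\subseteq M$ put $\lfloor Z\rfloor=\{\lfloor z\rfloor: z\in Z\}$ and $$\Lambda(Y,Z)=\bigcup_{r\ge1}(Y\lfloor Z\rfloor)^r\ \cup\ \bigcup_{r\ge0}(Y\lfloor Z\rfloor)^rY\ \cup\ \bigcup_{r\ge1}(\lfloor Z\rfloor Y)^r\ \cup\ \bigcup_{r\ge0}(\lfloor Z\rfloor Y)^r\lfloor Z\rfloor .$$ Put $\mathfrak{X}_0=X^+\cup\{1\}$, $\mathfrak{X}_{n+1}=\Lambda(X^+,\mathfrak{X}_n)\cup\{1\}$ for $n\ge0$, and $\mathfrak{X}_\infty=\bigcup_{n\ge0}\mathfrak{X}_n$. Every $\mathfrak{x}\in\mathfrak{X}_\infty\setminus\{1\}$ has a unique standard decomposition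 $\mathfrak{x}=\mathfrak{x}_1\cdots\mathfrak{x}_b$ with the $\mathfrak{x}_i$ alternately in $X^+$ and in $\lfloor\mathfrak{X}_\infty\rfloor$. Let $F_\kappa(A)$ be the free $\mathbf{k}$-module with basis $\mathfrak{X}_\infty$, $j_A:A\to F_\kappa(A)$ the linear injection extending $X\hookrightarrow\mathfrak{X}_\infty$, and $P_A$ the linear map with $P_A(\mathfrak{x})=\lfloor\mathfrak{x}\rfloor$ for $\mathfrak{x}\in\mathfrak{X}_\infty$; also write $\lfloor u\rfloor=P_A(u)$ for any $u\in F_\kappa(A)$. The bilinear product $\diamond$ is defined on basis elements recursively (on the total number of bracket pairs in the two words, then on the total number of letters from $X^+$). First $1\diamond\mathfrak{x}=\mathfrak{x}\diamond1=\mathfrak{x}$. For $\mathfrak{x},\mathfrak{x}'\ne1$ with standard decompositions $\mathfrak{x}=\mathfrak{x}_1\cdots\mathfrak{x}_b$, $\mathfrak{x}'=\mathfrak{x}'_1\cdots\mathfrak{x}'_{b'}$, put $\mathfrak{u}=\mathfrak{x}_1\cdots\mathfrak{x}_{b-1}$, $\mathfrak{v}=\mathfrak{x}'_2\cdots\mathfrak{x}'_{b'}$ (equal to $1$ if empty). If exactly one of $\mathfrak{x}_b,\mathfrak{x}'_1$ is in $X^+$, then $\mathfrak{x}\diamond\mathfrak{x}'=\mathfrak{x}\mathfrak{x}'$ (concatenation). If $\mathfrak{x}_b,\mathfrak{x}'_1\in X^+$ and $\mathfrak{x}_b\cdot\mathfrak{x}'_1=c\,1+\sum_i c_ix_i$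 in $A$ with $x_i\in X^+$, then $\mathfrak{x}\diamond\mathfrak{x}'=c\,(\mathfrak{u}\diamond\mathfrak{v})+\sum_ic_i\,\mathfrak{u}x_i\mathfrak{v}$. If $\mathfrak{x}_b=\lfloor\overline{\mathfrak{x}}\rfloor$ and $\mathfrak{x}'_1=\lfloor\overline{\mathfrak{x}}'\rfloor$, then $$\mathfrak{x}\diamond\mathfrak{x}'=\mathfrak{u}\lfloor\lfloor\overline{\mathfrak{x}}\rfloor\diamond\overline{\mathfrak{x}}'\rfloor\mathfrak{v}+\mathfrak{u}\lfloor\overline{\mathfrak{x}}\diamond\lfloor\overline{\mathfrak{x}}'\rfloor\rfloor\mathfrak{v}+\kappa\,\big(\mathfrak{u}\diamond(\overline{\mathfrak{x}}\diamond\overline{\mathfrak{x}}')\big)\diamond\mathfrak{v},$$ with concatenation and brackets extended linearly. With these data $(F_\kappa(A),\diamond,P_A)$ and $j_A$ form the free modified Rota-Baxter algebra of weight $\kappa$ on $A$. The bialgebra structure (here $\kappa=-\lambda^2$ and $A$ is a bialgebra with coproduct $\Delta_A$ and counit $\varepsilon_A$). The map $-\lambda\,\mathrm{id}$ is a modified Rota-Baxter operator of weight $-\lambda^2$ on $\mathbf{k}$, and $\varepsilon_M:F_{-\lambda^2}(A)\to\mathbf{k}$ is the unique modified Rota-Baxter algebra morphism to $(\mathbf{k},-\lambda\,\mathrm{id})$ with $\varepsilon_M\circ j_A=\varepsilon_A$. The linear map $Q$ on $F_{-\lambda^2}(A)\otimes F_{-\lambda^2}(A)$ given by $Q(u\otimes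 v)=(P_A(u)+\lambda u)\otimes\varepsilon_M(v)1+u\otimes P_A(v)$ is a modified Rota-Baxter operator of weight $-\lambda^2$ for the componentwise product, and $\Delta_M$ is the unique modified Rota-Baxter algebra morphism from $(F_{-\lambda^2}(A),P_A)$ to $(F_{-\lambda^2}(A)\otimes F_{-\lambda^2}(A),Q)$ with $\Delta_M\circ j_A=(j_A\otimes j_A)\circ\Delta_A$. The quintuple $(F_{-\lambda^2}(A),\diamond,1,\Delta_M,\varepsilon_M)$ is a bialgebra. *)

(* Defs.v *)
From HB Require Import structures.
From mathcomp Require Import all_boot all_algebra finmap.
From mathcomp Require Import zify.
From mathcomp.classical Require Import boolp classical_sets.
From mathcomp.multinomials Require Import monalg.

Set Implicit Arguments.
Unset Strict Implicit.
Unset Printing Implicit Defensive.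

Import GRing.Theory.
Local Open Scope classical_set_scope.
Local Open Scope quotient_scope.
Local Open Scope ring_scope.

(* Tensor products over a commutative ring: the free commutative monoid on
   U * V (formal sums, as lists) modulo the congruence generated by the
   bilinearity relations. *)
Section Tensor.
Context {k : comNzRingType}.

Definition bilin (U V W : lmodType k) (f : U -> V -> W) : Prop :=
  (forall u, linear (f u)) /\ (forall v, linear (f^~ v)).

Inductive tensor_eq (U V : lmodType k) : seq (U * V) -> seq (U * V) -> Prop :=
| tensor_refl s : tensor_eq s s
| tensor_sym s t : tensor_eq s t -> tensor_eq t s
| tensor_trans s t r : tensor_eq s t -> tensor_eq t r -> tensor_eq s r
| tensor_cat s t s' t' :
    tensor_eq s s' -> tensor_eq t t' -> tensor_eq (s ++ t) (s' ++ t')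
| tensor_catC s t : tensor_eq (s ++ t) (t ++ s)
| tensor_Dl u u' v : tensor_eq [:: (u + u', v)] [:: (u, v); (u', v)]
| tensor_Dr u v v' : tensor_eq [:: (u, v + v')] [:: (u, v); (u, v')]
| tensor_Z a u v : tensor_eq [:: (a *: u, v)] [:: (u, a *: v)]
| tensor_0 v : tensor_eq [:: (0, v)] [::].

Definition tensor_eqb (U V : lmodType k) (s t : seq (U * V)) : bool :=
  `[< tensor_eq s t >].

Fact tensor_eqb_refl U V : reflexive (@tensor_eqb U V).
Proof. by move=> s; apply/asboolP; constructor. Qed.

Fact tensor_eqb_sym U V : symmetric (@tensor_eqb U V).
Proof. by move=> s t; apply/asboolP/asboolP; apply: tensor_sym. Qed.

Fact tensor_eqb_trans U V : transitive (@tensor_eqb U V).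
Proof.
by move=> t s r /asboolP st /asboolP tr; apply/asboolP; apply: tensor_trans tr.
Qed.

Canonical tensor_equiv U V := EquivRel (@tensor_eqb U V)
  (@tensor_eqb_refl U V) (@tensor_eqb_sym U V) (@tensor_eqb_trans U V).

Definition tensor (U V : lmodType k) := {eq_quot tensor_equiv U V}.

HB.instance Definition _ U V := Choice.on (tensor U V).
HB.instance Definition _ U V := EqQuotient.on (tensor U V).

Section Module.
Context (U V : lmodType k).
Implicit Types (s t : seq (U * V)) (x y z : tensor U V).

Definition tensor_pi s : tensor U V := \pi s.

Lemma tensor_piP s t : tensor_pi s = tensor_pi t <-> tensor_eq s t.
Proof. by split => [/eqquotP/asboolP|st]; last by apply/eqquotP/asboolP. Qed.

Lemma tensor_reprK x : tensor_pi (repr x) = x. Proof. exact: reprK. Qed.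

Lemma tensor_repr s : tensor_eq (repr (tensor_pi s)) s.
Proof. by apply/tensor_piP; rewrite tensor_reprK. Qed.

Definition tensor_add x y := tensor_pi (repr x ++ repr y).
Definition tensor_scale (a : k) x :=
  tensor_pi [seq (a *: p.1, p.2) | p <- repr x].
Definition tensor_opp x := tensor_scale (-1) x.

Lemma tensor_scale_eq a s t : tensor_eq s t ->
  tensor_eq [seq (a *: p.1, p.2) | p <- s] [seq (a *: p.1, p.2) | p <- t].
Proof.
elim=> {s t} /=.
- by move=> s; constructor.
- by move=> s t _; apply: tensor_sym.
- by move=> s t r _ st _; apply: tensor_trans.
- by move=> s t s' t' _ ss' _ tt'; rewrite !map_cat; apply: tensor_cat.
- by move=> s t; rewrite !map_cat; apply: tensor_catC.
- by move=> u u' v; rewrite scalerDr; apply: tensor_Dl.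
- by move=> u v v'; apply: tensor_Dr.
- by move=> b u v; rewrite scalerA mulrC -scalerA; apply: tensor_Z.
- by move=> v; rewrite scaler0; apply: tensor_0.
Qed.

Lemma tensor_addE s t : tensor_add (tensor_pi s) (tensor_pi t) = tensor_pi (s ++ t).
Proof. by apply/tensor_piP/tensor_cat; apply: tensor_repr. Qed.

Lemma tensor_scaleE a s :
  tensor_scale a (tensor_pi s) = tensor_pi [seq (a *: p.1, p.2) | p <- s].
Proof. by apply/tensor_piP/tensor_scale_eq/tensor_repr. Qed.

Lemma tensor_scaleDl_eq a b s :
  tensor_eq [seq ((a + b) *: p.1, p.2) | p <- s]
    ([seq (a *: p.1, p.2) | p <- s] ++ [seq (b *: p.1, p.2) | p <- s]).
Proof.
elim: s => [|[u v] s IH] /=; first by constructor.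
set sa := [seq (a *: _, _) | _ <- s] in IH *.
set sb := [seq (b *: _, _) | _ <- s] in IH *.
rewrite scalerDl -[X in tensor_eq X]cat1s.
apply: tensor_trans (tensor_cat (tensor_Dl _ _ _) IH) _.
have -> : [:: (a *: u, v); (b *: u, v)] ++ sa ++ sb =
    [:: (a *: u, v)] ++ ([:: (b *: u, v)] ++ sa) ++ sb by [].
have -> : (a *: u, v) :: sa ++ (b *: u, v) :: sb =
    [:: (a *: u, v)] ++ (sa ++ [:: (b *: u, v)]) ++ sb by rewrite -catA.
apply: tensor_cat; first by constructor.
by apply: tensor_cat; [apply: tensor_catC | constructor].
Qed.

Lemma tensor_scale0_eq s : tensor_eq [seq ((0 : k) *: p.1, p.2) | p <- s] [::].
Proof.
elim: s => [|[u v] s IH] /=; first by constructor.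
by rewrite scale0r; apply: (tensor_cat (@tensor_0 U V v) IH).
Qed.

Fact tensor_addA : associative tensor_add.
Proof.
move=> x y z; rewrite -(tensor_reprK x) -(tensor_reprK y) -(tensor_reprK z).
by rewrite !tensor_addE catA.
Qed.

Fact tensor_addC : commutative tensor_add.
Proof.
move=> x y; rewrite -(tensor_reprK x) -(tensor_reprK y) !tensor_addE.
by apply/tensor_piP; apply: tensor_catC.
Qed.

Fact tensor_add0 : left_id (tensor_pi [::]) tensor_add.
Proof. by move=> x; rewrite -(tensor_reprK x) tensor_addE. Qed.

Fact tensor_addN : left_inverse (tensor_pi [::]) tensor_opp tensor_add.
Proof.
move=> x; rewrite -(tensor_reprK x) /tensor_opp tensor_scaleE tensor_addE.
apply/tensor_piP; set s := repr x.
have -> : s = [seq ((1 : k) *: p.1, p.2) | p <- s] :> seq (U * V).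
  by rewrite -[LHS]map_id; apply: eq_map => -[u v]; rewrite /= scale1r.
rewrite -map_comp (eq_map (g := fun p => (-1 *: p.1, p.2))); last first.
  by move=> p /=; rewrite scale1r.
apply: tensor_trans (tensor_sym (tensor_scaleDl_eq _ _ _)) _.
by rewrite addNr; apply: tensor_scale0_eq.
Qed.

HB.instance Definition _ := GRing.isZmodule.Build (tensor U V)
  tensor_addA tensor_addC tensor_add0 tensor_addN.

Fact tensor_scaleA a b x :
  tensor_scale a (tensor_scale b x) = tensor_scale (a * b) x.
Proof.
rewrite -(tensor_reprK x) !tensor_scaleE -map_comp; congr tensor_pi.
by apply: eq_map => p /=; rewrite scalerA.
Qed.

Fact tensor_scale1 : left_id 1 tensor_scale.
Proof.
move=> x; rewrite -(tensor_reprK x) tensor_scaleE; congr tensor_pi.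
by rewrite -[RHS]map_id; apply: eq_map => -[u v]; rewrite /= scale1r.
Qed.

Fact tensor_scaleDr : right_distributive tensor_scale +%R.
Proof.
move=> a x y; have addE (z t : tensor U V) : z + t = tensor_add z t by [].
rewrite !addE -(tensor_reprK x) -(tensor_reprK y) tensor_addE !tensor_scaleE.
by rewrite tensor_addE map_cat.
Qed.

Fact tensor_scaleDl x : {morph tensor_scale^~ x : a b / a + b}.
Proof.
move=> a b; rewrite -(tensor_reprK x) !tensor_scaleE.
by rewrite [RHS]tensor_addE; apply/tensor_piP/tensor_scaleDl_eq.
Qed.

HB.instance Definition _ := GRing.Zmodule_isLmodule.Build k (tensor U V)
  tensor_scaleA tensor_scale1 tensor_scaleDr tensor_scaleDl.

Lemma tensor_piD s t : tensor_pi s + tensor_pi t = tensor_pi (s ++ t).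
Proof. exact: tensor_addE. Qed.

Lemma tensor_piZ a s :
  a *: tensor_pi s = tensor_pi [seq (a *: p.1, p.2) | p <- s].
Proof. exact: tensor_scaleE. Qed.

Definition tens (u : U) (v : V) : tensor U V := tensor_pi [:: (u, v)].

End Module.

(* The linear map induced by a bilinear map f; see tensor_liftE and
   tensor_lift_linear. *)
Definition tensor_lift (U V W : lmodType k) (f : U -> V -> W)
  (x : tensor U V) : W := \sum_(p <- repr x) f p.1 p.2.

Section Universal.
Context (U V W : lmodType k).

Lemma tensor_piE (s : seq (U * V)) :
  tensor_pi s = \sum_(p <- s) tens p.1 p.2.
Proof.
elim: s => [|[u v] s IH]; first by rewrite big_nil.
by rewrite big_cons -IH tensor_piD.
Qed.

Lemma tens_bilin : bilin (@tens U V).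
Proof.
split=> [u a v v'|v a u u'].
  rewrite /tens tensor_piZ tensor_piD; apply/tensor_piP.
  apply: tensor_trans (tensor_Dr _ _ _) _.
  rewrite -cat1s -[X in tensor_eq _ X]cat1s.
  by apply: tensor_cat; [apply/tensor_sym/tensor_Z | constructor].
by rewrite /tens tensor_piZ tensor_piD; apply/tensor_piP/tensor_Dl.
Qed.

Context (f : U -> V -> W) (f_bilin : bilin f).

Lemma tensor_lift_eq s t : tensor_eq s t ->
  \sum_(p <- s) f p.1 p.2 = \sum_(p <- t) f p.1 p.2.
Proof.
have [fr fl] := f_bilin.
have f0 v : f 0 v = 0.
  by have := fl v (-1) 0 0; rewrite scaler0 addr0 scaleN1r addNr.
elim=> {s t} //.
- by move=> s t r _ -> _ ->.
- by move=> s t s' t' _ ss' _ tt'; rewrite !big_cat /= ss' tt'.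
- by move=> s t; rewrite !big_cat /= addrC.
- move=> u u' v; rewrite !big_cons big_nil !addr0 /=.
  by have := fl v 1 u u'; rewrite !scale1r.
- move=> u v v'; rewrite !big_cons big_nil !addr0 /=.
  by have := fr u 1 v v'; rewrite !scale1r.
- move=> a u v; rewrite !big_cons big_nil !addr0 /=.
  have := fl v a u 0; rewrite f0 !addr0 => ->.
  have := fr u a v 0; rewrite addr0 => ->.
  have := fr u (-1) 0 0; rewrite scaler0 addr0 scaleN1r addNr => ->.
  by rewrite addr0.
- by move=> v; rewrite big_cons !big_nil addr0 /= f0.
Qed.

Lemma tensor_lift_pi s : tensor_lift f (tensor_pi s) = \sum_(p <- s) f p.1 p.2.
Proof. by apply/tensor_lift_eq/tensor_repr. Qed.

Lemma tensor_liftE u v : tensor_lift f (tens u v) = f u v.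
Proof. by rewrite tensor_lift_pi big_seq1. Qed.

Lemma tensor_lift_linear : linear (tensor_lift f).
Proof.
move=> a x y; rewrite -(tensor_reprK x) -(tensor_reprK y).
rewrite tensor_piZ tensor_piD !tensor_lift_pi.
rewrite big_cat big_map scaler_sumr; congr (_ + _); apply: eq_bigr => -[u v] _ /=.
have [fr fl] := f_bilin.
have f0 : f 0 v = 0.
  by have := fl v (-1) 0 0; rewrite scaler0 addr0 scaleN1r addNr.
by have := fl v a u 0; rewrite f0 !addr0.
Qed.

Lemma tensor_lift_unique (g : tensor U V -> W) :
  linear g -> (forall u v, g (tens u v) = f u v) -> g =1 tensor_lift f.
Proof.
move=> g_lin gE x; rewrite /tensor_lift -[in LHS](tensor_reprK x) tensor_piE.
have g0 : g 0 = 0.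
  by have := g_lin (-1) 0 0; rewrite scaler0 addr0 scaleN1r addNr.
elim: (repr x) => [|p s IH]; first by rewrite !big_nil g0.
by rewrite !big_cons -IH -gE -[tens _ _]scale1r g_lin !scale1r.
Qed.

End Universal.

Definition tensor_map (U V U' V' : lmodType k) (f : U -> U') (g : V -> V') :
  tensor U V -> tensor U' V' := tensor_lift (fun u v => tens (f u) (g v)).

Definition tensor_assoc (U V W : lmodType k) :
  tensor (tensor U V) W -> tensor U (tensor V W) :=
  tensor_lift (fun x w => tensor_lift (fun u v => tens u (tens v w)) x).

Definition tensor_mul (U V : lmodType k) (mulU : U -> U -> U)
  (mulV : V -> V -> V) (x y : tensor U V) : tensor U V :=
  tensor_lift (fun u v =>
    tensor_lift (fun u' v' => tens (mulU u u') (mulV v v')) y) x.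

End Tensor.

Notation "U ⊗ V" := (tensor U V) (at level 40, left associativity) : type_scope.

(* Algebras, coalgebras and bialgebras are predicates on operations carried by
   a k-module; k itself is the module k^o. *)
Section Bialgebras.
Context {k : comNzRingType}.

Definition span (V : lmodType k) (Y : set V) : set V :=
  [set v | exists s : seq V, exists c : V -> k,
     (forall x, x \in s -> Y x) /\ v = \sum_(x <- s) c x *: x].

Definition is_submodule (V : lmodType k) (Y : set V) : Prop :=
  [/\ Y 0, forall u v, Y u -> Y v -> Y (u + v) & forall a v, Y v -> Y (a *: v)].

Definition linearly_independent (V : lmodType k) (Y : set V) : Prop :=
  forall (s : seq V) (c : V -> k), uniq s -> (forall x, x \in s -> Y x) ->
    \sum_(x <- s) c x *: x = 0 -> forall x, x \in s -> c x = 0.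

Definition is_basis (V : lmodType k) (Y : set V) : Prop :=
  linearly_independent Y /\ span Y = setT.

Record is_algebra (V : lmodType k) (mul : V -> V -> V) (one : V) : Prop := {
  alg_bilin : bilin mul;
  alg_mulA : associative mul;
  alg_mul1l : left_id one mul;
  alg_mul1r : right_id one mul }.

Record is_alg_hom (U V : lmodType k) (mulU : U -> U -> U) (oneU : U)
    (mulV : V -> V -> V) (oneV : V) (f : U -> V) : Prop := {
  hom_linear : linear f;
  hom_mul : forall x y, f (mulU x y) = mulV (f x) (f y);
  hom_one : f oneU = oneV }.

Record is_coalgebra (V : lmodType k) (Delta : V -> V ⊗ V) (eps : V -> k^o) :
    Prop := {
  coalg_Delta_linear : linear Delta;
  coalg_eps_linear : linear eps;
  coalg_coassoc : forall x,
    tensor_assoc (tensor_map Delta id (Delta x)) = tensor_map id Delta (Delta x);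
  coalg_counitl : forall x, tensor_lift (fun a b => eps a *: b) (Delta x) = x;
  coalg_counitr : forall x, tensor_lift (fun a b => eps b *: a) (Delta x) = x }.

Record is_bialgebra (V : lmodType k) (mul : V -> V -> V) (one : V)
    (Delta : V -> V ⊗ V) (eps : V -> k^o) : Prop := {
  bialg_algebra : is_algebra mul one;
  bialg_coalgebra : is_coalgebra Delta eps;
  bialg_Delta : is_alg_hom mul one (tensor_mul mul mul) (tens one one) Delta;
  bialg_eps : is_alg_hom mul one *%R (1 : k^o) eps }.

(* The sum over p + q = n of the images of V_p ⊗ V_q in V ⊗ V. *)
Definition tensor_filtration (V : lmodType k) (Vn : nat -> set V) (n : nat) :
    set (V ⊗ V) :=
  span [set t | exists p q a b,
    [/\ (p + q)%N = n, Vn p a, Vn q b & t = tens a b]].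

Record is_filtered_bialgebra (V : lmodType k) (mul : V -> V -> V) (one : V)
    (Delta : V -> V ⊗ V) (eps : V -> k^o) (Vn : nat -> set V) : Prop := {
  filt_bialgebra : is_bialgebra mul one Delta eps;
  filt_submodule : forall n, is_submodule (Vn n);
  filt_increasing : forall n, Vn n `<=` Vn n.+1;
  filt_exhaustive : \bigcup_n Vn n = setT;
  filt_mul : forall p q x y, Vn p x -> Vn q y -> Vn (p + q)%N (mul x y);
  filt_Delta : forall n x, Vn n x -> tensor_filtration Vn n (Delta x) }.

Record is_connected (V : lmodType k) (one : V) (eps : V -> k^o)
    (Vn : nat -> set V) : Prop := {
  conn_unit : Vn 0%N = [set a *: one | a in [set: k]];
  conn_sum : forall x, exists a b, [/\ Vn 0%N a, eps b = 0 & x = a + b];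
  conn_direct : forall x, Vn 0%N x -> eps x = 0 -> x = 0 }.

Definition is_connected_filtered_bialgebra (V : lmodType k)
    (mul : V -> V -> V) (one : V) (Delta : V -> V ⊗ V) (eps : V -> k^o)
    (Vn : nat -> set V) : Prop :=
  is_filtered_bialgebra mul one Delta eps Vn /\ is_connected one eps Vn.

Record is_filtered_basis (V : lmodType k) (one : V) (eps : V -> k^o)
    (Vn : nat -> set V) (X : set V) (Xn : nat -> set V) : Prop := {
  fbasis_basis : is_basis X;
  fbasis_increasing : forall n, Xn n `<=` Xn n.+1;
  fbasis_exhaustive : X = \bigcup_n Xn n;
  fbasis_span : forall n, Vn n = span (Xn n);
  fbasis_augmented : forall x, X x -> x != one -> eps x = 0;
  fbasis_0 : Xn 0%N = [set one] }.

Definition is_antipode (V : lmodType k) (mul : V -> V -> V) (one : V)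
    (Delta : V -> V ⊗ V) (eps : V -> k^o) (S : V -> V) : Prop :=
  [/\ linear S,
      forall x, tensor_lift (fun a b => mul (S a) b) (Delta x) = eps x *: one &
      forall x, tensor_lift (fun a b => mul a (S b)) (Delta x) = eps x *: one].

Definition is_hopf_algebra (V : lmodType k) (mul : V -> V -> V) (one : V)
    (Delta : V -> V ⊗ V) (eps : V -> k^o) : Prop :=
  is_bialgebra mul one Delta eps /\ exists S, is_antipode mul one Delta eps S.

Definition is_mrb_morphism (U V : lmodType k)
    (mulU : U -> U -> U) (oneU : U) (PU : U -> U)
    (mulV : V -> V -> V) (oneV : V) (PV : V -> V) (f : U -> V) : Prop :=
  is_alg_hom mulU oneU mulV oneV f /\ forall x, f (PU x) = PV (f x).

End Bialgebras.

(* A well-bracketed string over T and two bracket symbols is encoded as a list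
   of trees, Leaf x being the letter x and Br s the bracketed word |_ s _|. *)
Inductive tree (T : Type) : Type := Leaf of T | Br of seq (tree T).
Arguments Leaf {T} _.
Arguments Br {T} _.

Section Trees.
Context {T : Type}.

Definition is_br (t : tree T) : bool := if t is Br _ then true else false.

(* The words of \mathfrak{X}_\infty: letters and bracketed words alternate, at
   every depth. *)
Fixpoint alternating_tree (t : tree T) : bool :=
  match t with
  | Leaf _ => true
  | Br s => sorted (fun a b => is_br a != is_br b) s && all alternating_tree s
  end.

Definition alternating (s : seq (tree T)) : bool :=
  sorted (fun a b => is_br a != is_br b) s && all alternating_tree s.

Fixpoint tree_size (t : tree T) : nat :=
  match t with
  | Leaf _ => 1
  | Br s => (sumn (map tree_size s)).+1
  end.

Definition forest_size (s : seq (tree T)) : nat := sumn (map tree_size s).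

Fixpoint tree_encode (t : tree T) : GenTree.tree T :=
  match t with
  | Leaf x => GenTree.Leaf x
  | Br s => GenTree.Node 0 (map tree_encode s)
  end.

Fixpoint tree_decode (t : GenTree.tree T) : tree T :=
  match t with
  | GenTree.Leaf x => Leaf x
  | GenTree.Node _ s => Br (map tree_decode s)
  end.

Lemma tree_encodeK : cancel tree_encode tree_decode.
Proof.
rewrite /cancel; fix IH 1; case=> [x|s] //=; congr Br.
by elim: s => [|t s IHs] //=; rewrite IH IHs.
Qed.

End Trees.

(* \mathfrak{X}_n and \mathfrak{X}_\infty as sets of strings over T and two
   brackets, inr true being the opening and inr false the closing one. By frakXP
   and forest_string_inj, forest_string is a bijection from alternating
   sequences of trees to \mathfrak{X}_\infty; everything after this section is
   written in terms of trees. *)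
Section Strings.
Context {T : Type}.
Implicit Types (s : seq (tree T)) (w z : seq (T + bool)).
Local Notation string := (seq (T + bool)).

Definition letters : set string := [set [:: inl x] | x in [set: T]].

Definition bracket (w : string) : string := inr true :: rcons w (inr false).

Definition brackets (Z : set string) : set string := [set bracket z | z in Z].

Definition set_cat (Y Z : set string) : set string :=
  [set y ++ z | y in Y & z in Z].

Definition set_pow (Y : set string) (r : nat) : set string :=
  iter r (set_cat Y) [set [::]].

Definition Lambda (Y Z : set string) : set string :=
  let YZ := set_cat Y (brackets Z) in
  let ZY := set_cat (brackets Z) Y in
  (\bigcup_(r in [set r | (0 < r)%N]) set_pow YZ r) `|`
  (\bigcup_r set_cat (set_pow YZ r) Y) `|`
  (\bigcup_(r in [set r | (0 < r)%N]) set_pow ZY r) `|`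
  (\bigcup_r set_cat (set_pow ZY r) (brackets Z)).

Fixpoint frakX (n : nat) : set string :=
  if n is n'.+1 then Lambda letters (frakX n') `|` [set [::]]
  else letters `|` [set [::]].

Fixpoint tree_string (t : tree T) : string :=
  match t with
  | Leaf x => [:: inl x]
  | Br s => bracket (flatten (map tree_string s))
  end.

Definition forest_string s : string := flatten (map tree_string s).

Definition alternating_from (b : bool) s : bool :=
  path (fun c d => c != d) b (map is_br s) && all alternating_tree s.

Lemma alternating_fromE b s :
  alternating_from b s -> alternating s.
Proof.
case: s => //= a s /andP[/= /andP[_ ps] alts].
by rewrite /alternating /= path_map in ps *; rewrite ps.
Qed.

Lemma alternating_cons a s :
  alternating (a :: s) = alternating_tree a && alternating_from (is_br a) s.
Proof. by rewrite /alternating /alternating_from /= path_map andbCA. Qed.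

Lemma set_pow_string b (Y Z : set string) r w :
  (forall y, Y y -> exists t, [/\ alternating_tree t, is_br t = ~~ b & tree_string t = y]) ->
  (forall z, Z z -> exists t, [/\ alternating_tree t, is_br t = b & tree_string t = z]) ->
  set_pow (set_cat Y Z) r w ->
  exists s, [/\ alternating_from b s, last b (map is_br s) = b & forest_string s = w].
Proof.
move=> hY hZ; elim: r w => [|r IH] w /=; first by move=> ->; exists [::].
case=> _ [y /hY[ty [aty bty <-]] [z /hZ[tz [atz btz <-]] <-]].
move=> [w' /IH [s [as_ ls sw']] <-]; exists (ty :: tz :: s).
rewrite /forest_string /= in sw' *; rewrite sw' catA; split=> //; last by rewrite btz.
move: as_; rewrite /alternating_from /= aty atz bty btz => /andP[-> ->].
by case: (b).
Qed.

Lemma Lambda_string (Z : set string) w :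
  (forall z, Z z -> exists2 s, alternating s & forest_string s = z) ->
  Lambda letters Z w -> exists2 s, alternating s & forest_string s = w.
Proof.
move=> hZ.
have hB z : brackets Z z ->
    exists t, [/\ alternating_tree t, is_br t = true & tree_string t = z].
  by move=> [_ /hZ[s alts <-] <-]; exists (Br s).
have hL y : letters y ->
    exists t, [/\ alternating_tree t, is_br t = false & tree_string t = y].
  by move=> [x _ <-]; exists (Leaf x).
have app b s t : alternating_from b s -> last b (map is_br s) = b ->
    alternating_tree t -> is_br t = ~~ b -> alternating (rcons s t).
  move=> /andP[ps alls] lb alt_t bt; apply: (@alternating_fromE b).
  by rewrite /alternating_from map_rcons rcons_path ps lb bt all_rcons alt_t; case: (b).
case=> [[[[r _]|[r _]]|[r _]]|[r _]].
- by move/(set_pow_string (b := true) hL hB) => [s [/alternating_fromE ? _ ?]]; apply: (@ex_intro2 _ _ _ s).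
- move=> [w1 /(set_pow_string (b := true) hL hB)[s [a1 a2 <-]] [_ /hL[t [b1 b2 <-]] <-]].
  exists (rcons s t); first exact: app a1 a2 b1 b2.
  by rewrite /forest_string map_rcons flatten_rcons.
- by move/(set_pow_string (b := false) hB hL) => [s [/alternating_fromE ? _ ?]]; apply: (@ex_intro2 _ _ _ s).
- move=> [w1 /(set_pow_string (b := false) hB hL)[s [a1 a2 <-]] [_ /hB[t [b1 b2 <-]] <-]].
  exists (rcons s t); first exact: app a1 a2 b1 b2.
  by rewrite /forest_string map_rcons flatten_rcons.
Qed.


Definition contents_in (Z : set string) (t : tree T) : Prop :=
  if t is Br s then Z (forest_string s) else True.

Lemma string_set_pow (Z : set string) b s :
  alternating_from b s ->
  (forall t, List.In t s -> contents_in Z t) ->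
  let YZ := if b then set_cat letters (brackets Z) else set_cat (brackets Z) letters in
  let Y := if b then letters else brackets Z in
  (exists2 r, (0 < r)%N || nilp s & set_pow YZ r (forest_string s)) \/
  (exists r, set_cat (set_pow YZ r) Y (forest_string s)).
Proof.
move=> alts hZ YZ Y; have [n] := ubnP (size s).
have hY (c : bool) t : is_br t = ~~ c -> contents_in Z t ->
    (if c then letters else brackets Z) (tree_string t).
  by case: t => [x|x]; case: c => //= _; [exists x | exists (forest_string x)].
elim: n s alts hZ => // n IH [|t [|t' s]] alts hZ /=; rewrite ?ltnS => lt_n.
- by left; exists 0%N.
- right; exists 0%N; exists [::] => //; exists (tree_string t).
    apply: hY; last by apply: hZ; left.
    by move: alts; rewrite /alternating_from /=; case: (b); case: is_br.
  by rewrite /forest_string /= cats0.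
have [bt bt' alts'] : [/\ is_br t = ~~ b, is_br t' = b & alternating_from b s].
  move: alts; rewrite /alternating_from /=.
  move=> /andP[/and3P[bt tt' ps] /and3P[_ _ alls]].
  have t'b : is_br t' = b by move: bt tt'; case: (b); do 2!case: is_br.
  split=> //; first by move: bt; case: (b); case: is_br.
  by rewrite -t'b ps.
have YZtt' : YZ (tree_string t ++ tree_string t').
  have Yt := hY b t bt (hZ t (or_introl erefl)).
  have Zt' := hY (~~ b) t' _ (hZ t' (or_intror (or_introl erefl))).
  rewrite negbK in Zt'; move: Yt (Zt' bt'); rewrite /YZ.
  by case: (b) => ? ?; exists (tree_string t) => //; exists (tree_string t').
have strE : forest_string (t :: t' :: s) =
    (tree_string t ++ tree_string t') ++ forest_string s.
  by rewrite /forest_string /= catA.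
have [||[r _ powr]|[r [w powr [y Yy wy]]]] := IH s alts'.
- by move=> t0 st0; apply: hZ; right; right.
- exact: leq_trans lt_n.
- left; exists r.+1; first by [].
  by rewrite strE; exists (tree_string t ++ tree_string t') => //; exists (forest_string s).
- right; exists r.+1; exists ((tree_string t ++ tree_string t') ++ w).
    by exists (tree_string t ++ tree_string t') => //; exists w.
  by exists y => //; rewrite strE -wy catA.
Qed.

Lemma string_Lambda (Z : set string) s : alternating s ->
  (forall t, List.In t s -> contents_in Z t) ->
  (Lambda letters Z `|` [set [::]]) (forest_string s).
Proof.
case: s => [|a s] alts hZ; first by right.
have [b alt_b] : exists b, alternating_from b (a :: s).
  exists (~~ is_br a); move: alts; rewrite alternating_cons /alternating_from /=.
  by case: (is_br a) => /= /andP[-> /andP[-> ->]].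
left; have := string_set_pow alt_b hZ; case: (b) => /=.
  case=> [[r]|[r]]; first by rewrite orbF => r0 h; left; left; left; exists r.
  by move=> h; left; left; right; exists r.
case=> [[r]|[r]]; first by rewrite orbF => r0 h; left; right; exists r.
by move=> h; right; exists r.
Qed.

Lemma forest_string_frakX n s : alternating s -> (forest_size s <= n)%N ->
  frakX n (forest_string s).
Proof.
elim: n s => [|n IH] s alts.
  by case: s alts => [|[x|x] s] _ //; right.
move=> le_n; apply: string_Lambda => // t.
elim: s alts le_n => // a s IHs; rewrite alternating_cons => /andP[alta /alternating_fromE alts].
move=> le_n /= [<-|ts]; last first.
  by apply: IHs => //; apply: leq_trans le_n; apply: leq_addl.
case: a alta le_n => //= x altx le_n; apply: IH => //.
by rewrite -ltnS; apply: leq_trans le_n; rewrite ltnS; apply: leq_addr.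
Qed.

Lemma frakXP w : (exists n, frakX n w) <->
  exists2 s, alternating s & forest_string s = w.
Proof.
split=> [[n]|[s alts <-]]; last by exists (forest_size s); apply: forest_string_frakX.
elim: n w => [|n IH] w /= [].
- by case=> x _ <-; apply: (@ex_intro2 _ _ _ [:: Leaf x]).
- by move=> ->; apply: (@ex_intro2 _ _ _ [::]).
- exact: Lambda_string.
- by move=> ->; apply: (@ex_intro2 _ _ _ [::]).
Qed.

Lemma forest_string_cat_inj s s' (r r' : string) :
  ohead r = None \/ ohead r = Some (inr false) ->
  ohead r' = None \/ ohead r' = Some (inr false) ->
  forest_string s ++ r = forest_string s' ++ r' -> s = s' /\ r = r'.
Proof.
have [n] := ubnP (forest_size s); elim: n s s' r r' => // n IH s s' r r'.
case: s => [|[x|x] s]; case: s' => [|[y|y] s'] //; rewrite /forest_string /=.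
- by move=> _ [] hr _ rE; rewrite rE in hr.
- by move=> _ [] hr _ rE; rewrite rE in hr.
- by move=> _ _ [] hr rE; rewrite -rE in hr.
- rewrite ltnS => lt_n hr hr' [-> E].
  by have [|->] := IH s s' r r' _ hr hr' E.
- by move=> _ _ [] hr rE; rewrite -rE in hr.
- rewrite ltnS => lt_n hr hr' [].
  rewrite !cat_rcons -!catA => E.
  have lex : (forest_size x < n)%N by apply: leq_trans lt_n; rewrite ltnS leq_addr.
  have les : (forest_size s < n)%N by apply: leq_trans lt_n; rewrite ltnS leq_addl.
  have [||->] := IH x y _ _ lex _ _ E; [by right | by right |].
  by move=> [] E'; have [->] := IH s s' r r' les hr hr' E'.
Qed.

Lemma forest_string_inj : injective forest_string.
Proof.
move=> s s' E; apply: (proj1 (@forest_string_cat_inj s s' [::] [::] _ _ _)).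
- by left.
- by left.
- by rewrite !cats0.
Qed.

End Strings.

HB.instance Definition _ (T : choiceType) :=
  Choice.copy (tree T) (can_type (@tree_encodeK T)).

Definition word (T : choiceType) := {s : seq (tree T) | alternating s}.

(* The default value is never used: all sequences this is applied to below
   are alternating. *)
Definition mkword (T : choiceType) (s : seq (tree T)) : word T :=
  insubd (exist _ [::] isT : word T) s.

(* The linear extension of f to the free module with basis K; << w >> is the
   basis element w. *)
Definition lin_ext (k : comNzRingType) (K : choiceType) (V : lmodType k)
  (f : K -> V) (g : {malg k[K]}) : V := \sum_(w <- msupp g) g@_w *: f w.

Section FreeMRB.
Context {k : comNzRingType} {A : algType k}.
Context (X : set A) (kap : k).

Definition letter : choiceType := {x : A | x \in X `\ 1}.

(* F_kappa(A) as a k-module; it does not depend on kappa. *)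
Definition FA : lmodType k := {malg k[word letter]}.

Definition basis_word (s : seq (tree letter)) : FA := << mkword s >>.

Definition F1 : FA := basis_word [::].

Definition P_A : FA -> FA :=
  lin_ext (fun w => basis_word [:: Br (val w)]).

(* The coordinates of a on X, when X is a basis. *)
Definition coords (a : A) : {malg k[A]} :=
  xget 0 [set g : {malg k[A]} | (forall x, x \in msupp g -> X x) /\
                                a = \sum_(x <- msupp g) g@_x *: x].

(* The word of an element of X: the empty word for 1. *)
Definition letter_word (x : A) : seq (tree letter) :=
  if insub x is Some l then [:: Leaf l] else [::].

Definition j_A (a : A) : FA := lin_ext (fun x => basis_word (letter_word x)) (coords a).

(* The product of two words, with n a bound on the depth of the recursion; a
   bound larger than the total number of letters and bracket pairs in s and t
   gives the actual product. *)
Fixpoint word_mul (n : nat) (s t : seq (tree letter)) : FA :=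
  if n isn't n'.+1 then 0 else
  let mul (f g : FA) : FA :=
    lin_ext (fun w => lin_ext (fun w' => word_mul n' (val w) (val w')) g) f in
  match s, t with
  | [::], _ => basis_word t
  | _, [::] => basis_word s
  | a :: s', b :: v =>
    let u := belast a s' in
    match last a s', b with
    | Leaf x, Leaf y =>
      let c := coords (val x * val y) in
      c@_1 *: word_mul n' u v +
      \sum_(z <- msupp c | z != 1) c@_z *: basis_word (u ++ letter_word z ++ v)
    | Br x, Br y =>
      let in_context := lin_ext (fun w => basis_word (u ++ Br (val w) :: v)) in
      in_context (word_mul n' [:: Br x] y) +
      in_context (word_mul n' x [:: Br y]) +
      kap *: mul (mul (basis_word u) (word_mul n' x y)) (basis_word v)
    | _, _ => basis_word (s ++ t)
    end
  end.

Definition diamond (f g : FA) : FA :=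
  lin_ext (fun w => lin_ext (fun w' =>
    word_mul (forest_size (val w) + forest_size (val w')).+1 (val w) (val w')) g) f.


(* diamond1l to diamond_brackets show that diamond satisfies the intended
   recursion on words. *)

Lemma mkwordK s : alternating s -> val (mkword s : word letter) = s.
Proof. by move=> alt_s; rewrite /mkword insubdK. Qed.

Lemma alternating_cat (s t : seq (tree letter)) :
  alternating (s ++ t) -> alternating s /\ alternating t.
Proof.
rewrite /alternating all_cat => /andP[st /andP[-> ->]].
by have [-> ->] := cat_sorted2 st.
Qed.

Lemma alternating_Br (x : seq (tree letter)) :
  alternating [:: Br x] = alternating x.
Proof. by rewrite /alternating /= andbT. Qed.

Lemma lin_ext_basis (V : lmodType k) (f : word letter -> V) s :
  alternating s -> lin_ext f (basis_word s) = f (mkword s).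
Proof.
by move=> alt_s; rewrite /lin_ext /basis_word msuppU oner_eq0 big_seq_fset1
  mcoeffUU scale1r.
Qed.

Lemma P_A_basis s : alternating s -> P_A (basis_word s) = basis_word [:: Br s].
Proof. by move=> alt_s; rewrite /P_A (lin_ext_basis _ alt_s) (mkwordK alt_s). Qed.

Lemma forest_size_mkword s :
  (forest_size (val (mkword s : word letter)) <= forest_size s)%N.
Proof. by rewrite /mkword /insubd; case: insubP => //= w _ ->. Qed.

Definition size_bounded (n : nat) (g : FA) : Prop :=
  forall w, w \in msupp g -> (forest_size (val w) <= n)%N.

Lemma size_bounded0 n : size_bounded n 0.
Proof. by move=> w; rewrite msupp0. Qed.

Lemma size_boundedD n f g :
  size_bounded n f -> size_bounded n g -> size_bounded n (f + g).
Proof.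
move=> bf bg w /(fsubsetP (msuppD_le _ _)); rewrite in_fsetU.
by case/orP; [apply: bf | apply: bg].
Qed.

Lemma size_boundedZ n a f : size_bounded n f -> size_bounded n (a *: f).
Proof. by move=> bf w /(fsubsetP (msuppZ_le _ _)); apply: bf. Qed.

Lemma size_bounded_basis n s : (forest_size s <= n)%N -> size_bounded n (basis_word s).
Proof.
move=> sn w /(fsubsetP msuppU_le); rewrite in_fset1 => /eqP->.
exact: leq_trans (forest_size_mkword s) sn.
Qed.

Lemma size_bounded_sum n (I : eqType) (r : seq I) (P : pred I) (F : I -> FA) :
  (forall i, i \in r -> P i -> size_bounded n (F i)) ->
  size_bounded n (\sum_(i <- r | P i) F i).
Proof.
move=> bF; rewrite big_seq_cond; elim/big_rec: _ => [|i f /andP[ir Pi] bf].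
  exact: size_bounded0.
by apply: size_boundedD => //; apply: bF.
Qed.

Lemma size_bounded_lin_ext n (f : word letter -> FA) (g : FA) :
  (forall w, w \in msupp g -> size_bounded n (f w)) ->
  size_bounded n (lin_ext f g).
Proof.
by move=> bf; apply: size_bounded_sum => w wg _; apply/size_boundedZ/bf.
Qed.

Lemma forest_size_cat (s t : seq (tree letter)) :
  forest_size (s ++ t) = (forest_size s + forest_size t)%N.
Proof. by rewrite /forest_size map_cat sumn_cat. Qed.

Lemma forest_size_Br (x v : seq (tree letter)) :
  forest_size (Br x :: v) = (forest_size x + forest_size v).+1.
Proof. by []. Qed.

Lemma forest_size_Leaf x (v : seq (tree letter)) :
  forest_size (Leaf x :: v) = (forest_size v).+1.
Proof. by []. Qed.

Lemma forest_size_letter_word z : (forest_size (letter_word z) <= 1)%N.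
Proof. by rewrite /letter_word; case: insubP. Qed.

Definition bilin_ext (f : seq (tree letter) -> seq (tree letter) -> FA)
    (g h : FA) : FA :=
  lin_ext (fun w => lin_ext (fun w' => f (val w) (val w')) h) g.

(* u |_ g _| v, extended linearly in g. *)
Definition in_context (u v : seq (tree letter)) : FA -> FA :=
  lin_ext (fun w => basis_word (u ++ Br (val w) :: v)).

Lemma word_mul_nill n t : word_mul n.+1 [::] t = basis_word t.
Proof. by []. Qed.

Lemma word_mul_nilr n s : word_mul n.+1 s [::] = basis_word s.
Proof. by case: s. Qed.

Lemma word_mul_rcons n u a b v : word_mul n.+1 (rcons u a) (b :: v) =
  match a, b with
  | Leaf x, Leaf y =>
    let c := coords (val x * val y) in
    c@_1 *: word_mul n u v +
    \sum_(z <- msupp c | z != 1) c@_z *: basis_word (u ++ letter_word z ++ v)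
  | Br x, Br y =>
    in_context u v (word_mul n [:: Br x] y) +
    in_context u v (word_mul n x [:: Br y]) +
    kap *: bilin_ext (word_mul n)
             (bilin_ext (word_mul n) (basis_word u) (word_mul n x y))
             (basis_word v)
  | _, _ => basis_word (rcons u a ++ b :: v)
  end.
Proof. by case: u => [|c u] /=; rewrite ?last_rcons ?belast_rcons; case: a; case: b. Qed.

Lemma size_bounded_bilin_ext f N n m g h :
  (forall s t, size_bounded (forest_size s + forest_size t) (f s t)) ->
  size_bounded n g -> size_bounded m h -> (n + m <= N)%N ->
  size_bounded N (bilin_ext f g h).
Proof.
move=> bf bg bh nmN; apply: size_bounded_lin_ext => w /bg wn.
apply: size_bounded_lin_ext => w' /bh w'm w'' /bf /leq_trans; apply.
by apply: leq_trans nmN; apply: leq_add.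
Qed.

Lemma size_bounded_word_mul n s t :
  size_bounded (forest_size s + forest_size t) (word_mul n s t).
Proof.
elim: n s t => [|n IH] s t; first exact: size_bounded0.
case/lastP: s => [|u a].
  by rewrite word_mul_nill; apply: size_bounded_basis.
case: t => [|b v].
  by rewrite word_mul_nilr; apply: size_bounded_basis; rewrite addn0.
rewrite word_mul_rcons -cats1 !forest_size_cat.
case: a => [x|x]; case: b => [y|y].
- apply: size_boundedD.
    apply: size_boundedZ => w /IH /leq_trans; apply.
    by rewrite /forest_size /=; lia.
  apply: size_bounded_sum => z _ _; apply/size_boundedZ/size_bounded_basis.
  have := forest_size_letter_word z; rewrite !forest_size_cat /forest_size /=.
  by lia.
- by apply: size_bounded_basis; rewrite !forest_size_cat.
- by apply: size_bounded_basis; rewrite !forest_size_cat.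
- apply: size_boundedD; first apply: size_boundedD.
  + apply: size_bounded_lin_ext => w /IH; rewrite forest_size_Br => ww.
    apply: size_bounded_basis; rewrite forest_size_cat !forest_size_Br.
    by move: ww; rewrite /forest_size /=; lia.
  + apply: size_bounded_lin_ext => w /IH; rewrite forest_size_Br => ww.
    apply: size_bounded_basis; rewrite forest_size_cat !forest_size_Br.
    by move: ww; rewrite /forest_size /=; lia.
  apply: size_boundedZ.
  apply: (size_bounded_bilin_ext (n := forest_size u + (forest_size x + forest_size y)) IH).
  + apply: (size_bounded_bilin_ext IH) => //; exact: size_bounded_basis.
  + exact: size_bounded_basis.
  by rewrite /forest_size /=; lia.
Qed.

Lemma eq_lin_ext (V : lmodType k) (f f' : word letter -> V) (g : FA) :
  (forall w, w \in msupp g -> f w = f' w) -> lin_ext f g = lin_ext f' g.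
Proof. by move=> ff'; apply: eq_big_seq => w wg; rewrite ff'. Qed.

Lemma eq_bilin_ext f f' n m g h :
  (forall s t, (forest_size s <= n)%N -> (forest_size t <= m)%N ->
     f s t = f' s t) ->
  size_bounded n g -> size_bounded m h -> bilin_ext f g h = bilin_ext f' g h.
Proof.
move=> ff' bg bh; apply: eq_lin_ext => w /bg wn.
by apply: eq_lin_ext => w' /bh; apply: ff'.
Qed.

Lemma word_mul_stable n m s t :
  (forest_size s + forest_size t < n)%N ->
  (forest_size s + forest_size t < m)%N -> word_mul n s t = word_mul m s t.
Proof.
elim: n m s t => [|n IH] m s t; first by rewrite ltn0.
case: m => [|m]; first by rewrite !ltn0.
case/lastP: s => [|u a]; first by rewrite !word_mul_nill.
case: t => [|b v]; first by rewrite !word_mul_nilr.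
rewrite !word_mul_rcons -cats1 forest_size_cat.
case: a => [x|x]; case: b => [y|y]; [|by []|by []|].
  rewrite !forest_size_Leaf => lt_n lt_m.
  by rewrite (IH m u v) //; lia.
rewrite !forest_size_Br => lt_n lt_m.
have fs0 : forest_size ([::] : seq (tree letter)) = 0%N by [].
rewrite fs0 in lt_n lt_m.
rewrite (IH m [:: Br x] y); try by rewrite forest_size_Br fs0; lia.
rewrite (IH m x [:: Br y]); try by rewrite forest_size_Br fs0; lia.
rewrite (IH m x y); try by lia.
have bI := size_bounded_word_mul.
have E1 : bilin_ext (word_mul n) (basis_word u) (word_mul m x y) =
          bilin_ext (word_mul m) (basis_word u) (word_mul m x y).
  apply: (@eq_bilin_ext _ _ (forest_size u) (forest_size x + forest_size y)).
  + by move=> s t su tx; apply: IH; lia.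
  + exact: size_bounded_basis.
  + exact: bI.
have -> : bilin_ext (word_mul n)
    (bilin_ext (word_mul n) (basis_word u) (word_mul m x y)) (basis_word v) =
  bilin_ext (word_mul m)
    (bilin_ext (word_mul n) (basis_word u) (word_mul m x y)) (basis_word v).
  apply: (@eq_bilin_ext _ _ (forest_size u + (forest_size x + forest_size y))
                            (forest_size v)).
  + by move=> s t su tv; apply: IH; lia.
  + apply: (size_bounded_bilin_ext (bI n) _ (bI m x y) (leqnn _)).
    exact: size_bounded_basis.
  + exact: size_bounded_basis.
by rewrite E1.
Qed.

Lemma diamond_word_mul n s t : alternating s -> alternating t ->
  (forest_size s + forest_size t < n)%N ->
  diamond (basis_word s) (basis_word t) = word_mul n s t.
Proof.
move=> alt_s alt_t lt_n; rewrite /diamond !lin_ext_basis // !mkwordK //.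
exact: word_mul_stable.
Qed.

Lemma diamondE n g h N M : size_bounded N g -> size_bounded M h ->
  (N + M < n)%N -> bilin_ext (word_mul n) g h = diamond g h.
Proof.
move=> bg bh lt_n; apply: eq_lin_ext => w /bg wN; apply: eq_lin_ext => w' /bh wM.
apply: word_mul_stable (ltnSn _).
exact: leq_ltn_trans (leq_add wN wM) lt_n.
Qed.

Local Opaque basis_word P_A diamond word_mul in_context.

Lemma diamond1l s : alternating s ->
  diamond F1 (basis_word s) = basis_word s.
Proof. by move=> alt_s; rewrite (diamond_word_mul _ _ (ltnSn _)). Qed.

Lemma diamond1r s : alternating s ->
  diamond (basis_word s) F1 = basis_word s.
Proof.
by move=> alt_s; rewrite (diamond_word_mul _ _ (ltnSn _)) //; case: s {alt_s}.
Qed.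

Lemma diamond_concat u a b v :
  alternating (rcons u a) -> alternating (b :: v) -> is_br a != is_br b ->
  diamond (basis_word (rcons u a)) (basis_word (b :: v)) =
  basis_word (rcons u a ++ b :: v).
Proof.
move=> alt_u alt_v ab; rewrite (diamond_word_mul _ _ (ltnSn _)) //.
by rewrite word_mul_rcons; case: a b ab {alt_u alt_v} => [x|x] [y|y].
Qed.

Lemma diamond_letters u (x y : letter) v :
  alternating (rcons u (Leaf x)) -> alternating (Leaf y :: v) ->
  let c := coords (val x * val y) in
  diamond (basis_word (rcons u (Leaf x))) (basis_word (Leaf y :: v)) =
  c@_1 *: diamond (basis_word u) (basis_word v) +
  \sum_(z <- msupp c | z != 1) c@_z *: basis_word (u ++ letter_word z ++ v).
Proof.
move=> alt_u alt_v c.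
have [_ av] : alternating [:: Leaf y] /\ alternating v by exact: alternating_cat.
have [au _] : alternating u /\ alternating [:: Leaf x].
  by apply: alternating_cat; rewrite cats1.
set n := (forest_size (rcons u (Leaf x)) + forest_size (Leaf y :: v))%N.
rewrite [LHS](diamond_word_mul alt_u alt_v (ltnSn n)) [LHS]word_mul_rcons.
rewrite (diamond_word_mul (n := n) au av) //.
by rewrite /n -cats1 forest_size_cat !forest_size_Leaf; lia.
Qed.

Lemma diamond_brackets u x y v :
  alternating (rcons u (Br x)) -> alternating (Br y :: v) ->
  diamond (basis_word (rcons u (Br x))) (basis_word (Br y :: v)) =
  in_context u v (diamond (P_A (basis_word x)) (basis_word y)) +
  in_context u v (diamond (basis_word x) (P_A (basis_word y))) +
  kap *: diamond (diamond (basis_word u) (diamond (basis_word x) (basis_word y)))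
                 (basis_word v).
Proof.
move=> alt_u alt_v.
have [ay av] : alternating [:: Br y] /\ alternating v by exact: alternating_cat.
have [au ax] : alternating u /\ alternating [:: Br x].
  by apply: alternating_cat; rewrite cats1.
have [alt_x alt_y] : alternating x /\ alternating y.
  by rewrite -(alternating_Br x) -(alternating_Br y).
set n := (forest_size (rcons u (Br x)) + forest_size (Br y :: v))%N.
have nE : n = (forest_size u + forest_size x + forest_size y + forest_size v).+2.
  by rewrite /n -cats1 forest_size_cat !forest_size_Br /forest_size /=; lia.
have E1 : diamond (P_A (basis_word x)) (basis_word y) = word_mul n [:: Br x] y.
  rewrite (P_A_basis alt_x); apply: (diamond_word_mul ax alt_y).
  by rewrite forest_size_Br nE /forest_size /=; lia.
have E2 : diamond (basis_word x) (P_A (basis_word y)) = word_mul n x [:: Br y].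
  rewrite (P_A_basis alt_y); apply: (diamond_word_mul alt_x ay).
  by rewrite forest_size_Br nE /forest_size /=; lia.
have E3 : diamond (basis_word x) (basis_word y) = word_mul n x y.
  by apply: (diamond_word_mul alt_x alt_y); rewrite nE; lia.
have bI := @size_bounded_word_mul n x y.
have bu := size_bounded_basis (leqnn (forest_size u)).
have bv := size_bounded_basis (leqnn (forest_size v)).
have E4 : bilin_ext (word_mul n) (basis_word u) (word_mul n x y) =
          diamond (basis_word u) (word_mul n x y).
  by apply: (diamondE bu bI); rewrite nE; lia.
have buxy := size_bounded_bilin_ext (@size_bounded_word_mul n) bu bI (leqnn _).
have E5 : bilin_ext (word_mul n)
    (bilin_ext (word_mul n) (basis_word u) (word_mul n x y)) (basis_word v) =
    diamond (bilin_ext (word_mul n) (basis_word u) (word_mul n x y)) (basis_word v).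
  by apply: (diamondE buxy bv); rewrite nE; lia.
rewrite [LHS](diamond_word_mul alt_u alt_v (ltnSn n)) [LHS]word_mul_rcons.
by rewrite E5 E4 -E1 -E2 -E3.
Qed.

Local Transparent basis_word P_A diamond word_mul in_context.

End FreeMRB.

Definition Q_op (k : comNzRingType) (A : algType k) (X : set A) (lam : k)
    (epsM : FA X -> k^o) : FA X ⊗ FA X -> FA X ⊗ FA X :=
  tensor_lift (fun u v : FA X =>
    tens (P_A u + lam *: u) (epsM v *: F1 X) + tens u (P_A v)).

(* Main.v *)
(** Each word of F(A) receives a weight: a letter x weighs the least n with x in
   X_n (hence at least 1), a pair of brackets weighs 1, and weights add up. The
   words of weight at most n span the n-th step of the filtration. It is
   multiplicative because the recursion defining the product never increases
   the weight, and connected because only the empty word has weight 0.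

   Associativity of the product is proved by induction on the total size of
   three words s, t, r: the product is computed at the junctions, two trees of
   the same type multiply to trees of this type plus a smaller remainder, and
   everything reduces to three letters, where it is associativity of A, or to
   three brackets, where it follows from the Rota-Baxter identity.

   F(A) is generated as an algebra by j(A) and the bracket P, so that counit
   and coassociativity propagate from A by induction. Once the right counit
   holds, the formula for Delta on brackets becomes
     Delta(P x) = (P x + lam x) (x) 1 + (id (x) P)(Delta x),
   which gives the step for P in the counit and coassociativity laws, and shows
   that Delta respects the filtration.

   Finally q = eta eps - id kills 1, so its n+1-st convolution power kills the
   n-th step of the filtration, and the sum of the powers of q is an antipode. *)

Require Import Defs.
From HB Require Import structures.
From mathcomp Require Import all_boot all_algebra finmap.
From mathcomp Require Import zify.
From mathcomp.classical Require Import boolp classical_sets.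
From mathcomp.multinomials Require Import monalg.
Import GRing.Theory.
Local Open Scope ring_scope.
Local Open Scope classical_set_scope.

Set Implicit Arguments.
Unset Strict Implicit.
Unset Printing Implicit Defensive.

(* all_algebra has another span, for subspaces of a vectType. *)
Local Notation span := Defs.span.

(** * Linear maps and tensor products *)

Section Linear.
Context {k : comNzRingType}.
Implicit Types U V W : lmodType k.

Lemma lin0 U V (f : U -> V) : linear f -> f 0 = 0.
Proof.
by move=> f_lin; have := f_lin (-1) 0 0; rewrite scaler0 addr0 scaleN1r addNr.
Qed.

Lemma linD U V (f : U -> V) : linear f -> {morph f : x y / x + y}.
Proof. by move=> f_lin x y; have := f_lin 1 x y; rewrite !scale1r. Qed.

Lemma linZ U V (f : U -> V) : linear f -> forall a x, f (a *: x) = a *: f x.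
Proof.
by move=> f_lin a x; have := f_lin a x 0; rewrite (lin0 f_lin) !addr0.
Qed.

Lemma lin_sum U V (f : U -> V) (f_lin : linear f) I (r : seq I) (P : pred I) F :
  f (\sum_(i <- r | P i) F i) = \sum_(i <- r | P i) f (F i).
Proof. exact: (big_morph f (linD f_lin) (lin0 f_lin)). Qed.

Lemma equalizer_submodule V W (f g : V -> W) :
  linear f -> linear g -> is_submodule (fun x => f x = g x).
Proof.
move=> hf hg; split=> [|u v fu fv|a v fv]; first by rewrite !lin0.
  by rewrite !linD // fu fv.
by rewrite !linZ // fv.
Qed.

Lemma lin_id V : linear (fun x : V => x). Proof. by []. Qed.

Lemma lin_cst0 U V : linear (fun _ : U => 0 : V).
Proof. by move=> a x y; rewrite scaler0 addr0. Qed.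

Lemma lin_comp U V W (f : V -> W) (g : U -> V) :
  linear f -> linear g -> linear (fun x => f (g x)).
Proof. by move=> hf hg a x y; rewrite hg hf. Qed.

Lemma lin_add U V (f g : U -> V) :
  linear f -> linear g -> linear (fun x => f x + g x).
Proof. by move=> hf hg a x y; rewrite hf hg scalerDr addrACA. Qed.

Lemma lin_scale U V c (f : U -> V) : linear f -> linear (fun x => c *: f x).
Proof. by move=> hf a x y; rewrite hf scalerDr !scalerA mulrC. Qed.

Lemma lin_scalel U V (f : U -> k^o) (v : V) :
  linear f -> linear (fun x => f x *: v).
Proof. by move=> hf a x y; rewrite hf scalerDl scalerA. Qed.

Lemma lin_bl U V W (m : U -> V -> W) : bilin m -> forall v, linear (fun u => m u v).
Proof. by case. Qed.

Lemma lin_br U V W (m : U -> V -> W) : bilin m -> forall u, linear (m u).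
Proof. by case. Qed.

Lemma bilin_comp (U V W U' V' : lmodType k) (m : U -> V -> W) (f : U' -> U) (g : V' -> V) :
  bilin m -> linear f -> linear g -> bilin (fun u v => m (f u) (g v)).
Proof.
move=> [mr ml] hf hg; split=> [u|v]; first exact: lin_comp.
exact: (lin_comp (ml _) hf).
Qed.

Section LinExt.
Variables (K : choiceType) (V : lmodType k).
Implicit Types (g : {malg k[K]}) (f : K -> V).

(** Coefficients vanish outside the support, so the sum may run over any finite set containing it.
    Several elements can then be treated over a common set. *)
Lemma lin_extEw (E : {fset K}) f g : (msupp g `<=` E)%fset ->
  lin_ext f g = \sum_(w <- E) g@_w *: f w.
Proof.
move=> gE; rewrite /lin_ext.
rewrite (big_fset_incl _ gE) // => w _ /mcoeff_outdom ->.
by rewrite scale0r.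
Qed.

Lemma lin_ext_linear f : linear (lin_ext f).
Proof.
move=> a g h; set E := (msupp (a *: g + h) `|` (msupp g `|` msupp h))%fset.
rewrite !(@lin_extEw E) ?fsubsetUl ?fsubsetUr //.
- rewrite scaler_sumr -big_split /=; apply: eq_bigr => w _.
  by rewrite mcoeffD mcoeffZ scalerDl scalerA.
- by rewrite /E fsetUA fsubsetUr.
- by rewrite /E fsetUCA fsubsetUl.
Qed.

Lemma lin_extU f w : lin_ext f << w >> = f w.
Proof. by rewrite /lin_ext msuppU oner_eq0 big_seq_fset1 mcoeffUU scale1r. Qed.

Lemma lin_ext_split x f g :
  lin_ext f g = g@_x *: f x + \sum_(w <- msupp g | w != x) g@_w *: f w.
Proof.
rewrite /lin_ext (bigID (pred1 x)) /=; congr (_ + _).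
have [xg|xg] := boolP (x \in msupp g).
  by rewrite -big_filter filter_pred1_uniq ?fset_uniq // big_seq1.
rewrite (mcoeff_outdom xg) scale0r big_seq_cond big1 // => w /andP[wg /eqP wx].
by rewrite wx (negbTE xg) in wg.
Qed.

Lemma malg_basisE g : g = \sum_(w <- msupp g) g@_w *: << w >>.
Proof.
rewrite [LHS]monalgE; apply: eq_bigr => w _; apply/malgP => v.
by rewrite mcoeffZ !mcoeffU mulr_natr.
Qed.

Lemma malg_lin_eq (L L' : {malg k[K]} -> V) g : linear L -> linear L' ->
  (forall w, w \in msupp g -> L << w >> = L' << w >>) -> L g = L' g.
Proof.
move=> hL hL' LL'; rewrite (malg_basisE g) !lin_sum //.
by apply: eq_big_seq => w wg; rewrite !linZ // LL'.
Qed.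

End LinExt.

Section Tensors.
Variables (U V : lmodType k).

Lemma tensor_ind (P : U ⊗ V -> Prop) : P 0 ->
  (forall x y, P x -> P y -> P (x + y)) -> (forall u v, P (tens u v)) ->
  forall x, P x.
Proof.
move=> P0 PD Pt x; rewrite -(tensor_reprK x) tensor_piE.
by elim/big_rec: _ => // p y _; apply: PD.
Qed.

Lemma tensor_lin_eq (W : lmodType k) (f g : U ⊗ V -> W) : linear f -> linear g ->
  (forall u v, f (tens u v) = g (tens u v)) -> f =1 g.
Proof.
move=> hf hg fg; apply: tensor_ind => [|x y fx fy|//]; first by rewrite !lin0.
by rewrite !linD // fx fy.
Qed.

Lemma tensDl (u u' : U) (v : V) : tens (u + u') v = tens u v + tens u' v.
Proof. exact: (linD (lin_bl (tens_bilin U V) v)). Qed.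

Lemma tensDr (u : U) (v v' : V) : tens u (v + v') = tens u v + tens u v'.
Proof. exact: (linD (lin_br (tens_bilin U V) u)). Qed.

Lemma tensZl a (u : U) (v : V) : tens (a *: u) v = a *: tens u v.
Proof. exact: (linZ (lin_bl (tens_bilin U V) v)). Qed.

Lemma tensZr a (u : U) (v : V) : tens u (a *: v) = a *: tens u v.
Proof. exact: (linZ (lin_br (tens_bilin U V) u)). Qed.

End Tensors.

Lemma tens_bilin_comp (U V U' V' : lmodType k) (f : U' -> U) (g : V' -> V) :
  linear f -> linear g -> bilin (fun u v => tens (f u) (g v)).
Proof. exact/bilin_comp/tens_bilin. Qed.

Lemma tensor_map_linear (U V U' V' : lmodType k) (f : U -> U') (g : V -> V') :
  linear f -> linear g -> linear (tensor_map f g).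
Proof. by move=> hf hg; apply/tensor_lift_linear/tens_bilin_comp. Qed.

Lemma tensor_mapE (U V U' V' : lmodType k) (f : U -> U') (g : V -> V') u v :
  linear f -> linear g -> tensor_map f g (tens u v) = tens (f u) (g v).
Proof. by move=> hf hg; rewrite /tensor_map tensor_liftE //; apply: tens_bilin_comp. Qed.

(** The lift is a sum over a representative of [x] that does not depend on [t], so linearity in [t]
    holds term by term. *)
Lemma lift_family_linear (T U V W : lmodType k) (f : T -> U -> V -> W) x :
  (forall t, bilin (f t)) -> (forall u v, linear (fun t => f t u v)) ->
  linear (fun t => tensor_lift (f t) x).
Proof.
move=> hf fl a t t'; rewrite /tensor_lift scaler_sumr -big_split /=.
by apply: eq_bigr => p _; rewrite fl.
Qed.

Lemma tensor_assoc_bilin (U V W : lmodType k) :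
  bilin (fun (x : U ⊗ V) (w : W) => tensor_lift (fun u v => tens u (tens v w)) x).
Proof.
have hf w : bilin (fun (u : U) (v : V) => tens u (tens v w)).
  split=> [u|v]; last exact: lin_bl (tens_bilin _ _) _.
  by apply: lin_comp (lin_br (tens_bilin _ _) u) (lin_bl (tens_bilin _ _) w).
split=> [x|w]; last exact: tensor_lift_linear.
apply: lift_family_linear => // u v.
by apply: lin_comp (lin_br (tens_bilin _ _) u) (lin_br (tens_bilin _ _) v).
Qed.

Lemma tensor_assoc_linear (U V W : lmodType k) : linear (@tensor_assoc k U V W).
Proof. exact/tensor_lift_linear/tensor_assoc_bilin. Qed.

Lemma tensor_assocE (U V W : lmodType k) (u : U) (v : V) (w : W) :
  tensor_assoc (tens (tens u v) w) = tens u (tens v w).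
Proof.
rewrite /tensor_assoc tensor_liftE; last exact: tensor_assoc_bilin.
rewrite tensor_liftE //; split=> [u'|v']; last exact: lin_bl (tens_bilin _ _) _.
by apply: lin_comp (lin_br (tens_bilin _ _) u') (lin_bl (tens_bilin _ _) w).
Qed.

Section TensorMul.
Variables (U V : lmodType k) (mU : U -> U -> U) (mV : V -> V -> V).
Hypotheses (hU : bilin mU) (hV : bilin mV).

Lemma tensor_mul_inner u v :
  bilin (fun u' v' => tens (mU u u') (mV v v')).
Proof. by apply: tens_bilin_comp; apply: lin_br. Qed.

Lemma tensor_mul_outer y :
  bilin (fun u v => tensor_lift (fun u' v' => tens (mU u u') (mV v v')) y).
Proof.
split=> [u|v]; apply: lift_family_linear => [t|u' v'];
  try exact: tensor_mul_inner.
  exact: (lin_comp (lin_br (tens_bilin _ _) _) (lin_bl hV v')).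
exact: (lin_comp (lin_bl (tens_bilin _ _) _) (lin_bl hU _)).
Qed.

Lemma tensor_mul_bilin : bilin (tensor_mul mU mV).
Proof.
split=> [x|y]; last exact/tensor_lift_linear/tensor_mul_outer.
have E y : tensor_mul mU mV x y = \sum_(p <- repr x)
    tensor_lift (fun u' v' => tens (mU p.1 u') (mV p.2 v')) y by [].
move=> a y y'; rewrite !E scaler_sumr -big_split; apply: eq_bigr => p _.
exact: (tensor_lift_linear (tensor_mul_inner p.1 p.2)).
Qed.

Lemma tensor_mulE u v u' v' :
  tensor_mul mU mV (tens u v) (tens u' v') = tens (mU u u') (mV v v').
Proof.
rewrite /tensor_mul tensor_liftE; last exact: tensor_mul_outer.
by rewrite tensor_liftE //; apply: tensor_mul_inner.
Qed.

Lemma tensor_bilin_ind (P : U ⊗ V -> U ⊗ V -> Prop) :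
  (forall y, P 0 y) -> (forall x, P x 0) ->
  (forall x x' y, P x y -> P x' y -> P (x + x') y) ->
  (forall x y y', P x y -> P x y' -> P x (y + y')) ->
  (forall u v u' v', P (tens u v) (tens u' v')) -> forall x y, P x y.
Proof.
move=> P0l P0r PDl PDr Pt x y; elim/tensor_ind: x => // [x x'|u v]; first exact: PDl.
by elim/tensor_ind: y => // y y'; apply: PDr.
Qed.

End TensorMul.

(** Both sides are additive in each tensor, which reduces multiplicativity to pure tensors. This
    serves for the counit contractions and for the iterated coproducts. *)
Lemma tensor_lin_mul (U V W : lmodType k) mU mV (mW : W -> W -> W)
    (f : U ⊗ V -> W) : bilin mU -> bilin mV -> bilin mW -> linear f ->
  (forall u v u' v', f (tens (mU u u') (mV v v')) =
    mW (f (tens u v)) (f (tens u' v'))) ->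
  forall x y, f (tensor_mul mU mV x y) = mW (f x) (f y).
Proof.
move=> hU hV hW hf fM; have hUV := tensor_mul_bilin hU hV.
apply: tensor_bilin_ind => [y|x|x x' y fx fx'|x y y' fy fy'|u v u' v'].
- by rewrite (lin0 (lin_bl hUV _)) lin0 // (lin0 (lin_bl hW _)).
- by rewrite (lin0 (lin_br hUV _)) lin0 // (lin0 (lin_br hW _)).
- by rewrite (linD (lin_bl hUV _)) !(linD hf) (linD (lin_bl hW _)) fx fx'.
- by rewrite (linD (lin_br hUV _)) !(linD hf) (linD (lin_br hW _)) fy fy'.
by rewrite tensor_mulE // fM.
Qed.

End Linear.

(** * Words *)

(* The constants of Defs are locked: otherwise each failed comparison of two
   products or of two basis elements unfolds them. *)
HB.lock Definition wd (k : comNzRingType) (A : algType k) (X : set A)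
  (s : seq (tree (letter X))) : FA X := basis_word s.
HB.lock Definition brk (k : comNzRingType) (A : algType k) (X : set A)
  (f : FA X) : FA X := P_A f.
HB.lock Definition dia (k : comNzRingType) (A : algType k) (X : set A) (kap : k)
  (f g : FA X) : FA X := diamond kap f g.
HB.lock Definition jA (k : comNzRingType) (A : algType k) (X : set A)
  (a : A) : FA X := j_A X a.
HB.lock Definition lword (k : comNzRingType) (A : algType k) (X : set A)
  (x : A) : seq (tree (letter X)) := letter_word X x.
HB.lock Definition ctx (k : comNzRingType) (A : algType k) (X : set A)
  (u v : seq (tree (letter X))) (f : FA X) : FA X :=
  lin_ext (fun w => basis_word (u ++ val w ++ v)) f.

Section BasisWords.
Context {k : comNzRingType} {A : algType k} (X : set A).
Local Notation tr := (tree (letter X)).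
Local Notation F := (FA X).
Implicit Types (s t r u v : seq tr) (f g : F).

Lemma wd_val (w : word (letter X)) : wd (val w) = << w >> :> F.
Proof.
by rewrite unlock /basis_word; congr << _ >>; apply: val_inj; rewrite mkwordK ?(valP w).
Qed.

Lemma wdE : @basis_word k A X = @wd k A X. Proof. by rewrite unlock. Qed.

Lemma brkE : @P_A k A X = @brk k A X. Proof. by rewrite unlock. Qed.

Lemma diaE kap : @diamond k A X kap = @dia k A X kap. Proof. by rewrite unlock. Qed.

Lemma jAE : j_A X = @jA k A X. Proof. by rewrite unlock. Qed.

Lemma lwordE : letter_word X = @lword k A X. Proof. by rewrite unlock. Qed.

Lemma F1E : F1 X = wd [::]. Proof. by rewrite unlock. Qed.

Lemma msupp_wd s w : alternating s -> w \in msupp (wd s : F) -> val w = s.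
Proof.
rewrite unlock => alt_s /(fsubsetP msuppU_le); rewrite in_fset1 => /eqP->.
exact: mkwordK.
Qed.

Lemma lin_ext_wd (V : lmodType k) (h : word (letter X) -> V) (h' : seq tr -> V) s :
  (forall w, h w = h' (val w)) -> alternating s -> lin_ext h (wd s) = h' s.
Proof. by move=> hh' alt_s; rewrite -wdE lin_ext_basis // hh' mkwordK. Qed.

Lemma brk_linear : linear (@brk k A X).
Proof. by rewrite unlock; apply: lin_ext_linear. Qed.

Lemma brk_wd s : alternating s -> brk (wd s) = wd [:: Br s].
Proof. by move=> alt_s; rewrite -wdE -brkE (P_A_basis alt_s). Qed.

Lemma ctx_linear u v : linear (@ctx k A X u v).
Proof. by move=> c f g; rewrite !ctx.unlock lin_ext_linear. Qed.

Lemma ctx_wd u v s : alternating s -> ctx u v (wd s) = wd (u ++ s ++ v).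
Proof.
move=> alt_s; rewrite ctx.unlock.
by rewrite (lin_ext_wd (h' := fun s => basis_word (u ++ s ++ v)) _ alt_s) // wdE.
Qed.

End BasisWords.

(** * Coordinates on the basis, and the map j from A to F(A) *)

Section Coordinates.
Context {k : comNzRingType} {A : algType k} (X : set A).
Hypotheses (X_basis : is_basis X) (X1 : X 1).
Implicit Types (a x y : A) (g : {malg k[A]}).

Lemma coords_exist a : exists g : {malg k[A]},
  (forall x, x \in msupp g -> X x) /\ a = lin_ext id g.
Proof.
have [_ /seteqP[_ /(_ a I)]] := X_basis; rewrite /span /= => -[s [c [sX aE]]].
(* The list [s] may contain a vector several times; the formal sum adds up the coefficients of its
   occurrences. *)
exists (\sum_(x <- s) c x *: << x >>); split.
  move=> x; apply: contraTP => nXx; rewrite -mcoeff_eq0 raddf_sum /=.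
  rewrite big_seq big1 // => y ys; rewrite mcoeffZ mcoeffU.
  by case: eqP => [yx|]; rewrite ?mulr0 //; case: nXx; rewrite -yx; apply: sX.
rewrite (lin_sum (lin_ext_linear id)) aE; apply: eq_bigr => x _.
by rewrite (linZ (lin_ext_linear id)) lin_extU.
Qed.

Lemma coordsP a :
  (forall x, x \in msupp (coords X a) -> X x) /\ a = lin_ext id (coords X a).
Proof.
rewrite /coords; case: xgetP => [g -> //|/=].
by have [g gP] := coords_exist a => /(_ g).
Qed.

(** The difference of two expansions is a vanishing combination of distinct elements of [X], so
    linear independence makes it zero. *)
Lemma coords_unique a g : (forall x, x \in msupp g -> X x) ->
  a = lin_ext id g -> coords X a = g.
Proof.
have [cX aE] := coordsP a => gX aE'; apply/eqP; rewrite -subr_eq0.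
set d := _ - _; have dX x : x \in msupp d -> X x.
  by move=> /(fsubsetP (msuppB_le _ _)); rewrite in_fsetU => /orP[/cX|/gX].
have d0 : \sum_(x <- msupp d) d@_x *: x = 0.
  rewrite -[LHS]/(lin_ext id d) /d (linD (lin_ext_linear _)) -scaleN1r.
  by rewrite (linZ (lin_ext_linear _)) -aE -aE' scaleN1r subrr.
have dz := proj1 X_basis _ _ (fset_uniq _) dX d0.
apply/eqP/malgP => x; rewrite mcoeff0; apply/eqP.
by rewrite mcoeff_eq0; apply/negP => xd; have := xd; rewrite -mcoeff_neq0 dz ?eqxx.
Qed.

Lemma coords_linear : linear (coords X).
Proof.
move=> c x y; have [xX xE] := coordsP x; have [yX yE] := coordsP y.
apply: coords_unique => [z /(fsubsetP (msuppD_le _ _))|].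
  by rewrite in_fsetU => /orP[/(fsubsetP (msuppZ_le _ _))/xX|/yX].
by rewrite lin_ext_linear -xE -yE.
Qed.

Lemma coords_basis x : X x -> coords X x = << x >>.
Proof.
move=> Xx; apply: coords_unique; last by rewrite lin_extU.
by move=> y; rewrite msuppU oner_eq0 in_fset1 => /eqP->.
Qed.

Lemma jA_linear : linear (@jA k A X).
Proof. by rewrite unlock =>  c x y; rewrite /j_A coords_linear lin_ext_linear. Qed.

Lemma jA_basis x : X x -> jA X x = wd (lword X x).
Proof. by move=> Xx; rewrite -jAE -wdE -lwordE /j_A coords_basis // lin_extU. Qed.

Lemma lword1 : lword X 1 = [::].
Proof.
by rewrite -lwordE /letter_word insubN //; apply/negP => /set_mem[_]; apply.
Qed.

Lemma jA1 : jA X 1 = wd [::].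
Proof. by rewrite (jA_basis X1) lword1. Qed.

Lemma lword_letter x : X x -> x != 1 ->
  exists2 l : letter X, val l = x & lword X x = [:: Leaf l].
Proof.
move=> Xx x1; have xX : x \in X `\ 1 by apply/mem_set; split=> //; apply/eqP.
by rewrite -lwordE /letter_word; case: insubP => [l _ lx|/negP//]; exists l.
Qed.

Lemma letterP (l : letter X) : X (val l) /\ val l != 1.
Proof. by have [Xl /eqP] := set_mem (valP l). Qed.

Lemma lword_val (l : letter X) : lword X (val l) = [:: Leaf l].
Proof. by rewrite -lwordE /letter_word valK. Qed.

Lemma jA_letter (l : letter X) : jA X (val l) = wd [:: Leaf l].
Proof. by have [Xl _] := letterP l; rewrite (jA_basis Xl) lword_val. Qed.

Lemma jA_coords a : let c := coords X a in
  jA X a = c@_1 *: wd [::] + \sum_(z <- msupp c | z != 1) c@_z *: wd (lword X z).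
Proof.
by rewrite -jAE -wdE -lwordE /j_A (lin_ext_split 1) lwordE lword1.
Qed.

Lemma A_lin_eq (V : lmodType k) (L L' : A -> V) : linear L -> linear L' ->
  (forall x, X x -> L x = L' x) -> L =1 L'.
Proof.
move=> hL hL' LL' a; have [cX ->] := coordsP a; rewrite /lin_ext !lin_sum //.
by apply: eq_big_seq => x /cX /LL' xE; rewrite !linZ //= xE.
Qed.

End Coordinates.

(** * Alternating sequences, size bounds and one-tree words *)

Section Words.
Context {k : comNzRingType} {A : algType k} (X : set A).
Local Notation tr := (tree (letter X)).
Local Notation F := (FA X).
Implicit Types (s t r u v : seq tr) (a b c d : tr) (f g h p : F).

Lemma F_lin_eq (V : lmodType k) (L L' : F -> V) f : linear L -> linear L' ->
  (forall s, alternating s -> (exists2 w, w \in msupp f & val w = s) ->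
     L (wd s) = L' (wd s)) -> L f = L' f.
Proof.
move=> hL hL' LL'; apply: malg_lin_eq => // w wf.
by rewrite -wd_val LL' ?(valP w) //; exists w.
Qed.

Lemma F_lin_eq_all (V : lmodType k) (L L' : F -> V) : linear L -> linear L' ->
  (forall s, alternating s -> L (wd s) = L' (wd s)) -> L =1 L'.
Proof. by move=> hL hL' LL' f; apply: F_lin_eq => // s alt_s _; apply: LL'. Qed.

Lemma sorted_rcons_cons (T : Type) (e : rel T) (u v : seq T) (a : T) :
  sorted e (u ++ a :: v) = sorted e (rcons u a) && sorted e (a :: v).
Proof.
by case: u => [|x u] //=; rewrite cat_path rcons_path /= andbA.
Qed.

Lemma alternating_glue u a v :
  alternating (u ++ a :: v) = alternating (rcons u a) && alternating (a :: v).
Proof.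
rewrite /alternating sorted_rcons_cons all_cat all_rcons /=.
by case: (alternating_tree a); rewrite /= ?andbF // andbACA.
Qed.

Lemma alternating_cons2 a b v : alternating (a :: b :: v) =
  [&& alternating_tree a, is_br a != is_br b & alternating (b :: v)].
Proof. by rewrite /alternating /= andbCA -!andbA. Qed.

Lemma alternating1 a : alternating [:: a] = alternating_tree a.
Proof. by rewrite /alternating /= andbT. Qed.

Lemma alternating_head c b v : is_br c = is_br b -> alternating_tree c ->
  alternating (b :: v) -> alternating (c :: v).
Proof.
move=> cb altc; case: v => [|d v]; first by rewrite !alternating1.
by rewrite !alternating_cons2 cb altc => /and3P[_ -> ->].
Qed.

Lemma alternating_last c a u : is_br c = is_br a -> alternating_tree c ->
  alternating (rcons u a) -> alternating (rcons u c).
Proof.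
move=> ca altc; rewrite /alternating !all_rcons altc => /andP[h /andP[_ ->]].
case: u h => //= d u.
by rewrite !rcons_path /= ca andbT.
Qed.

Lemma alternating_behead a v : alternating (a :: v) ->
  alternating_tree a /\ alternating v.
Proof. by rewrite -cat1s => /alternating_cat[]; rewrite alternating1. Qed.

Lemma alternating_rcons u a : alternating (rcons u a) ->
  alternating u /\ alternating_tree a.
Proof. by rewrite -cats1 => /alternating_cat[? ]; rewrite alternating1. Qed.

(** This is the situation at the junction of a product, where two trees of one type merge into a
    tree of that type: both neighbours stay admissible. *)
Lemma alternating_mid u a b c v : is_br c = is_br a -> is_br c = is_br b ->
  alternating_tree c -> alternating (rcons u a) -> alternating (b :: v) ->
  alternating (u ++ c :: v).
Proof.
move=> ca cb altc alt_u alt_v; rewrite alternating_glue.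
by rewrite (alternating_last ca altc alt_u) (alternating_head cb altc alt_v).
Qed.

Lemma size_bounded_sub n m f : (n <= m)%N -> size_bounded n f -> size_bounded m f.
Proof. by move=> nm bf w /bf wn; apply: leq_trans nm. Qed.

Lemma size_bounded_wd n s : (forest_size s <= n)%N -> size_bounded n (wd s : F).
Proof. by rewrite -wdE; apply: size_bounded_basis. Qed.

Lemma size_bounded_brk n f : size_bounded n f -> size_bounded n.+1 (brk f).
Proof.
move=> bf; rewrite -brkE; apply: size_bounded_lin_ext => w /bf wn.
by apply: size_bounded_basis; rewrite forest_size_Br addn0 ltnS.
Qed.

(** Bracketing is separated from insertion between [u] and [v], so that products of two letters and
    of two brackets are both written with [ctx]. *)
Lemma in_contextE u v f : in_context u v f = ctx u v (brk f).
Proof.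
move: f; apply: (F_lin_eq_all (L := in_context u v) (L' := fun f => ctx u v (brk f))).
- exact: lin_ext_linear.
- exact: lin_comp (ctx_linear u v) (@brk_linear k A X).
move=> s alt_s; rewrite (brk_wd alt_s) ctx_wd ?alternating_Br //.
by rewrite /in_context (lin_ext_wd (h' := fun s => basis_word (u ++ Br s :: v)) _ alt_s) // wdE.
Qed.

Lemma ctx_nil f : ctx [::] [::] f = f.
Proof.
move: f; apply: F_lin_eq_all; [exact: ctx_linear | exact: lin_id |].
by move=> r alt_r; rewrite (ctx_wd _ _ alt_r) cats0.
Qed.

(** Trees of type [b] may replace a tree of that type at a junction without breaking alternation;
    the main part of the product of two trees of one type has this form. *)
Definition single (b : bool) f : Prop := forall w, w \in msupp f ->
  exists2 c, val w = [:: c] & is_br c = b.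

Lemma singleD (b : bool) f g : single b f -> single b g -> single b (f + g).
Proof.
by move=> hf hg w /(fsubsetP (msuppD_le _ _)); rewrite in_fsetU => /orP[/hf|/hg].
Qed.

Lemma singleZ (b : bool) x f : single b f -> single b (x *: f).
Proof. by move=> hf w /(fsubsetP (msuppZ_le _ _)) /hf. Qed.

Lemma single_sum (b : bool) (I : eqType) (r : seq I) (P : pred I) (G : I -> F) :
  (forall i, i \in r -> P i -> single b (G i)) ->
  single b (\sum_(i <- r | P i) G i).
Proof.
move=> bG; rewrite big_seq_cond; elim/big_rec: _ => [|i f /andP[ir Pi] bf].
  by move=> w; rewrite msupp0.
by apply: singleD => //; apply: bG.
Qed.

Lemma single_wd c : alternating_tree c -> single (is_br c) (wd [:: c]).
Proof.
move=> altc w /msupp_wd ->; first by exists c.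
by rewrite alternating1.
Qed.

Lemma single_brk f : single true (brk f).
Proof.
rewrite -brkE /P_A /lin_ext; apply: single_sum => w _ _; apply: singleZ.
by rewrite wdE; apply/(@single_wd (Br _))/(valP w).
Qed.

Lemma single_lin_eq (V : lmodType k) (L L' : F -> V) (b : bool) n f :
  linear L -> linear L' -> single b f -> size_bounded n f ->
  (forall c, alternating_tree c -> is_br c = b -> (forest_size [:: c] <= n)%N ->
     L (wd [:: c]) = L' (wd [:: c])) -> L f = L' f.
Proof.
move=> hL hL' sf bf LL'; apply: F_lin_eq => // s alt_s [w wf ws].
have [c wc cb] := sf w wf; have := bf w wf; move: alt_s.
by rewrite -ws wc alternating1 => altc cn; apply: LL'.
Qed.

End Words.

(** * Associativity of the product *)

(* Keeps lia from inspecting the rest of the context. *)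
Ltac slia :=
  repeat match goal with H : is_true (_ <= _)%N |- _ => move: H end;
  clear; repeat match goal with |- context [forest_size ?s] => generalize (forest_size s) end;
  lia.

(* The rearrangement needed in assoc_at_brk, stated for variables because AC
   rewriting is slow on the actual terms. *)
Fact addr_shuffle9 (V : zmodType) (a b c d e f g h i : V) :
  a + b + c + (d + (e + f + g) + h) + i = a + d + g + e + h + (b + f + i) + c.
Proof. by rewrite !addrA [LHS](ACl (1*4*7*5*8*2*6*9*3)). Qed.

Section Diamond.
Context {k : comNzRingType} {A : algType k} (X : set A) (kap : k).
Hypotheses (X_basis : is_basis X) (X1 : X 1).
Local Notation tr := (tree (letter X)).
Local Notation F := (FA X).
Local Notation B := (@wd k A X).
Local Notation P := (@brk k A X).
Local Notation fs := (@forest_size (letter X)).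
Local Notation "f ⋄ g" := (dia kap f g) (at level 40, left associativity).
Implicit Types (s t r u v : seq tr) (a b c d : tr) (f g h p : F).

Lemma dia_bilin : bilin (fun f g => f ⋄ g).
Proof.
rewrite -diaE; split=> [f|g]; last exact: lin_ext_linear.
have E g : diamond kap f g = \sum_(w <- msupp f) f@_w *: lin_ext (fun w' =>
    word_mul kap (fs (val w) + fs (val w')).+1 (val w) (val w')) g by [].
move=> c g g'; rewrite !E scaler_sumr -big_split; apply: eq_bigr => w _.
by rewrite lin_ext_linear scalerDr !scalerA mulrC.
Qed.

Lemma size_bounded_dia n m f g :
  size_bounded n f -> size_bounded m g -> size_bounded (n + m) (f ⋄ g).
Proof.
move=> bf bg; rewrite -diaE; apply: size_bounded_lin_ext => w /bf wn.
apply: size_bounded_lin_ext => w' /bg w'm.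
by apply: size_bounded_sub (@size_bounded_word_mul _ _ _ _ _ _ _); apply: leq_add.
Qed.

Lemma diaDl g : {morph (fun f => f ⋄ g) : f f' / f + f'}.
Proof. exact: (linD (lin_bl dia_bilin g)). Qed.
Lemma diaDr f : {morph (fun g => f ⋄ g) : g g' / g + g'}.
Proof. exact: (linD (lin_br dia_bilin f)). Qed.
Lemma diaZl (x : k) f g : (x *: f) ⋄ g = x *: (f ⋄ g).
Proof. exact: (linZ (lin_bl dia_bilin g)). Qed.
Lemma diaZr (x : k) f g : f ⋄ (x *: g) = x *: (f ⋄ g).
Proof. exact: (linZ (lin_br dia_bilin f)). Qed.
Lemma brkD : {morph P : f g / f + g}.
Proof. exact: (linD (@brk_linear k A X)). Qed.
Lemma brkZ (x : k) f : P (x *: f) = x *: P f.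
Proof. exact: (linZ (@brk_linear k A X)). Qed.

Local Notation BL := (lin_bl dia_bilin).
Local Notation BR := (lin_br dia_bilin).
Local Notation PL := (@brk_linear k A X).
Definition dE := (diaDl, diaDr, diaZl, diaZr, brkD, brkZ).

Lemma dia_concat u a b v :
  alternating (rcons u a) -> alternating (b :: v) -> is_br a != is_br b ->
  B (rcons u a) ⋄ B (b :: v) = B (rcons u a ++ b :: v).
Proof. by rewrite -wdE -diaE; apply: diamond_concat. Qed.

Lemma dia_letters u (x y : letter X) v :
  alternating (rcons u (Leaf x)) -> alternating (Leaf y :: v) ->
  let c := coords X (val x * val y) in
  B (rcons u (Leaf x)) ⋄ B (Leaf y :: v) =
  c@_1 *: (B u ⋄ B v) +
  \sum_(z <- msupp c | z != 1) c@_z *: B (u ++ lword X z ++ v).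
Proof. by rewrite -wdE -diaE -lwordE; apply: diamond_letters. Qed.

Lemma dia_brackets u x y v :
  alternating (rcons u (Br x)) -> alternating (Br y :: v) ->
  B (rcons u (Br x)) ⋄ B (Br y :: v) =
  ctx u v (P (P (B x) ⋄ B y)) + ctx u v (P (B x ⋄ P (B y))) +
  kap *: ((B u ⋄ (B x ⋄ B y)) ⋄ B v).
Proof.
move=> altu altv; rewrite -!in_contextE -wdE -diaE -brkE.
exact: diamond_brackets.
Qed.

Lemma dia_1l : left_id (B [::]) (dia kap).
Proof. by apply: F_lin_eq_all => [||s]; [exact: (BR _) | | by rewrite -wdE -diaE; apply: diamond1l]. Qed.

Lemma dia_1r : right_id (B [::]) (dia kap).
Proof. by apply: F_lin_eq_all => [||s]; [exact: (BL _) | | by rewrite -wdE -diaE; apply: diamond1r]. Qed.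

(** On words this is [dia_brackets] with empty contexts, where [ctx] is the identity and the outer
    factors are units. Linearity in each argument does the rest. *)
Lemma dia_brk f g :
  P f ⋄ P g = P (P f ⋄ g) + P (f ⋄ P g) + kap *: (f ⋄ g).
Proof.
move: f; apply: F_lin_eq_all => [||s alt_s].
- exact: lin_comp (BL _) PL.
- apply: lin_add (lin_scale _ (BL g)); apply: lin_add.
    exact: lin_comp PL (lin_comp (BL g) PL).
  exact: lin_comp PL (BL _).
move: g; apply: F_lin_eq_all => [||t alt_t].
- exact: lin_comp (BR _) PL.
- apply: lin_add (lin_scale _ (BR _)); apply: lin_add.
    exact: lin_comp PL (BR _).
  exact: lin_comp PL (lin_comp (BR _) PL).
have alt_s' : alternating (rcons [::] (Br s)) by rewrite alternating_Br.
have alt_t' : alternating [:: Br t] by rewrite alternating_Br.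
have := dia_brackets alt_s' alt_t'.
rewrite [rcons _ _]/= -(brk_wd alt_s) -(brk_wd alt_t) dia_1l dia_1r => ->.
by rewrite !ctx_nil.
Qed.

Lemma dia_concat1 a b v : alternating_tree a -> is_br a != is_br b ->
  alternating (b :: v) -> B [:: a] ⋄ B (b :: v) = B (a :: b :: v).
Proof.
move=> alta ab altv; apply: (@dia_concat [::]) => //.
by rewrite alternating1.
Qed.

(** Neighbouring trees in a word have different types, so their product is concatenation. Hence
    every word is the product of its trees. *)
Lemma dia_cons a v : alternating (a :: v) -> B (a :: v) = B [:: a] ⋄ B v.
Proof.
case: v => [|b v]; first by rewrite dia_1r.
by rewrite alternating_cons2 => /and3P[alta ab altv]; rewrite dia_concat1.
Qed.

(* p collects the new trees of the common type, and g the constant term of the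
   product of two letters, or the kap-term of the product of two brackets. Only
   g, whose size has dropped, calls for the induction hypothesis in the proof of
   associativity. *)
Lemma dia_same_type a b : is_br a = is_br b ->
  alternating_tree a -> alternating_tree b ->
  exists p g, [/\ single (is_br b) p, size_bounded (fs [:: a] + fs [:: b]) p,
    size_bounded (fs [:: a] + fs [:: b]).-1 g &
    forall u v, alternating (rcons u a) -> alternating (b :: v) ->
    B (rcons u a) ⋄ B (b :: v) = ctx u v p + (B u ⋄ g) ⋄ B v].
Proof.
case: a b => [x|x] [y|y] // _ alta altb.
  set c := coords X (val x * val y); have [cX _] := coordsP X_basis (val x * val y).
  have wE z : z \in msupp c -> z != 1 -> exists2 l, val l = z & lword X z = [:: Leaf l].
    by move=> /cX Xz z1; apply: lword_letter.
  exists (\sum_(z <- msupp c | z != 1) c@_z *: B (lword X z)), (c@_1 *: B [::]).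
  split.
  - apply: single_sum => z zc z1; apply: singleZ.
    by have [l _ ->] := wE z zc z1; apply: (@single_wd _ _ _ (Leaf l)).
  - apply: size_bounded_sum => z _ _; apply/size_boundedZ/size_bounded_wd.
    by rewrite -lwordE; exact: leq_trans (forest_size_letter_word X z) _.
  - exact/size_boundedZ/size_bounded_wd.
  move=> u v altu altv; rewrite dia_letters // -/c addrC; congr (_ + _).
    rewrite (lin_sum (ctx_linear u v)) big_seq_cond [RHS]big_seq_cond.
    apply: eq_bigr => z /andP[zc z1]; rewrite (linZ (ctx_linear u v)).
    by have [l _ ->] := wE z zc z1; rewrite ctx_wd.
  by rewrite !dE dia_1r.
have [altx alty] : alternating x /\ alternating y by split.
have bx := size_bounded_wd (leqnn (fs x)); have by_ := size_bounded_wd (leqnn (fs y)).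
have fsE z : fs [:: Br z] = (fs z).+1 by rewrite forest_size_Br addn0.
exists (P (P (B x) ⋄ B y) + P (B x ⋄ P (B y))), (kap *: (B x ⋄ B y)); split.
- by apply: singleD; apply: single_brk.
- rewrite !fsE addnS; apply: size_boundedD; apply: size_bounded_brk.
    exact: size_bounded_dia (size_bounded_brk bx) by_.
  rewrite addSnnS; exact: size_bounded_dia bx (size_bounded_brk by_).
- apply/size_boundedZ; apply: size_bounded_sub (size_bounded_dia bx by_).
  by rewrite !fsE; lia.
move=> u v altu altv; rewrite dia_brackets // (linD (ctx_linear u v)).
by rewrite !dE.
Qed.

(* Splitting off the tail of the second factor needs no induction, since the
   product is defined from the middle. *)
Lemma dia_split_right c d v : alternating_tree c -> alternating (d :: v) ->
  B [:: c] ⋄ B (d :: v) = (B [:: c] ⋄ B [:: d]) ⋄ B v.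
Proof.
move=> altc altv; have [altd altv'] := alternating_behead altv.
have [cd|cd] := eqVneq (is_br c) (is_br d); last first.
  rewrite !dia_concat1 ?alternating1 //.
  case: v altv altv' => [|e v] altv altv'; first by rewrite dia_1r.
  rewrite (@dia_concat [:: c] d) //.
  - by rewrite alternating_cons2 altc cd alternating1.
  - by move: altv; rewrite alternating_cons2 => /and3P[].
have [p [g [sp _ _ mulE]]] := dia_same_type cd altc altd.
have altc1 : alternating (rcons [::] c) by rewrite alternating1.
rewrite (mulE [::] v altc1 altv) (mulE [::] [::] altc1); last by rewrite alternating1.
rewrite !dE dia_1r; congr (_ + _).
apply: (F_lin_eq (L := ctx [::] v) (L' := fun p => ctx [::] [::] p ⋄ B v)).
- exact: ctx_linear.
- exact: (lin_comp (lin_bl dia_bilin _) (ctx_linear _ _)).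
move=> s alt_s [w /sp[e we eb] ws]; rewrite !ctx_wd // cats0 /=.
rewrite -ws we cat1s -dia_cons //.
by apply: alternating_head altv => //; move: alt_s; rewrite -ws we alternating1.
Qed.

Definition assoc_at f g h : Prop := (f ⋄ g) ⋄ h = f ⋄ (g ⋄ h).

(** Both sides are expanded by [dia_brk], the hypotheses reassociate the triple products with fewer
    brackets, and a second expansion yields the same nine terms on each side. *)
Lemma assoc_at_brk f g h : assoc_at f g h -> assoc_at (P f) g h ->
  assoc_at f (P g) h -> assoc_at f g (P h) -> assoc_at (P f) (P g) h ->
  assoc_at (P f) g (P h) -> assoc_at f (P g) (P h) ->
  assoc_at (P f) (P g) (P h).
Proof.
rewrite /assoc_at => fgh Pfgh fPgh fgPh PfPgh PfgPh fPgPh.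
rewrite [in LHS](dia_brk f g) [in RHS](dia_brk g h) !dE.
rewrite (dia_brk (P f ⋄ g) h) (dia_brk (f ⋄ P g) h).
rewrite (dia_brk f (P g ⋄ h)) (dia_brk f (g ⋄ P h)).
rewrite Pfgh fPgh fgPh -PfPgh PfgPh fPgPh.
rewrite (dia_brk f g) (dia_brk g h) !dE fgh.
exact: addr_shuffle9.
Qed.

Lemma A_mul_bilin : bilin (fun x y : A => x * y).
Proof.
split=> [x|y] e z z'; first by rewrite mulrDr scalerAr.
by rewrite mulrDl scalerAl.
Qed.

(** For two letters, [dia_letters] with empty contexts is the expansion of their product given by
    [jA_coords]. Associativity on three letters is thereby inherited from [A]. *)
Lemma jA_mul x y : jA X (x * y) = jA X x ⋄ jA X y.
Proof.
have jl := jA_linear X_basis.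
move: x; apply: (A_lin_eq X_basis).
- exact: lin_comp jl (lin_bl A_mul_bilin y).
- exact: lin_comp (BL _) jl.
move=> x Xx; have [->|x1] := eqVneq x 1; first by rewrite mul1r (jA1 X_basis X1) dia_1l.
move: y; apply: (A_lin_eq X_basis).
- exact: lin_comp jl (lin_br A_mul_bilin x).
- exact: lin_comp (BR _) jl.
move=> y Xy; have [->|y1] := eqVneq y 1; first by rewrite mulr1 (jA1 X_basis X1) dia_1r.
have [l lx _] := lword_letter Xx x1; have [l' ly _] := lword_letter Xy y1.
rewrite -lx -ly !(jA_letter X_basis).
have := @dia_letters [::] l l' [::] isT isT; rewrite [rcons _ _]/= => ->.
by rewrite jA_coords dia_1l; under [in RHS]eq_bigr do rewrite cats0.
Qed.

(** Both bracketings are linear in each factor. Testing only words in the supports lets size bounds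
    on the factors pass to the words. *)
Lemma assoc_ext f g h :
  (forall s t r, alternating s -> alternating t -> alternating r ->
    (exists2 w, w \in msupp f & val w = s) ->
    (exists2 w, w \in msupp g & val w = t) ->
    (exists2 w, w \in msupp h & val w = r) -> assoc_at (B s) (B t) (B r)) ->
  assoc_at f g h.
Proof.
move=> assocB; rewrite /assoc_at.
apply: (F_lin_eq (L := fun f => (f ⋄ g) ⋄ h) (L' := fun f => f ⋄ (g ⋄ h))).
- exact: lin_comp (BL _) (BL _).
- exact: BL.
move=> s alt_s sf.
apply: (F_lin_eq (L := fun g => (B s ⋄ g) ⋄ h) (L' := fun g => B s ⋄ (g ⋄ h))).
- exact: lin_comp (BL _) (BR _).
- exact: lin_comp (BR _) (BL _).
move=> t alt_t tg.
apply: (F_lin_eq (L := fun h => (B s ⋄ B t) ⋄ h) (L' := fun h => B s ⋄ (B t ⋄ h))).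
- exact: BR.
- exact: lin_comp (BR _) (BR _).
by move=> r alt_r rh; apply: assocB.
Qed.

(** * The induction step for associativity, at total size at most N *)

Section Step.
Variable N : nat.
Hypothesis IH : forall s t r, alternating s -> alternating t -> alternating r ->
  (fs s + fs t + fs r < N)%N -> assoc_at (B s) (B t) (B r).

Lemma assoc_lt n m l f g h : size_bounded n f -> size_bounded m g ->
  size_bounded l h -> (n + m + l < N)%N -> assoc_at f g h.
Proof.
move=> bf bg bh lt_N; apply: assoc_ext => s t r alt_s alt_t alt_r.
move=> [w /bf sn ws] [w' /bg tm wt] [w'' /bh rl wr].
by rewrite ws wt wr in sn tm rl; apply: IH => //; slia.
Qed.

Local Notation bwd s := (@size_bounded_wd k A X _ s (leqnn (fs s))).

Lemma fs_cons a v : fs (a :: v) = (fs [:: a] + fs v)%N.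
Proof. by rewrite -cat1s forest_size_cat. Qed.

Lemma fs_rcons u a : fs (rcons u a) = (fs u + fs [:: a])%N.
Proof. by rewrite -cats1 forest_size_cat. Qed.

Lemma fs_gt0 a : (0 < fs [:: a])%N.
Proof. by case: a. Qed.

(** As [t] is nonempty, the product with [r] is formed at the last tree of [t] and leaves [a]
    untouched. Only the remainder at the junction calls for the induction hypothesis. *)
Lemma assoc_concat a t r : alternating (a :: t) -> t != [::] -> alternating r ->
  (fs (a :: t) + fs r <= N)%N -> B (a :: t) ⋄ B r = B [:: a] ⋄ (B t ⋄ B r).
Proof.
case: r => [|b v]; first by move=> alt_at _ _ _; rewrite !dia_1r dia_cons.
case/lastP: t => // t c alt_at _ alt_bv le_N.
have [alt_a alt_t] := alternating_behead alt_at.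
have alt_at' : alternating (rcons (a :: t) c) by [].
have [_ alt_c] := alternating_rcons alt_t.
have [alt_b alt_v] := alternating_behead alt_bv.
have [alt_at'' _] := alternating_rcons alt_at'.
have [cb|cb] := eqVneq (is_br c) (is_br b); last first.
  rewrite (dia_concat alt_at') // dia_concat //.
  rewrite -dia_cons // cat_rcons -cat_cons alternating_glue alt_at'.
  by rewrite alternating_cons2 alt_c cb.
have [p [g [sp bp bg mulE]]] := dia_same_type cb alt_c alt_b.
have aE : B (a :: t) = B [:: a] ⋄ B t by exact: dia_cons.
rewrite -rcons_cons (mulE _ _ alt_at' alt_bv) (mulE _ _ alt_t alt_bv) dE; congr (_ + _).
  apply: (single_lin_eq (L := ctx (a :: t) v) (L' := fun p => B [:: a] ⋄ ctx t v p) _ _ sp bp).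
  - exact: ctx_linear.
  - exact: lin_comp (BR _) (ctx_linear _ _).
  move=> e alt_e eb _; rewrite !ctx_wd ?alternating1 //= -dia_cons //.
  have ec : is_br e = is_br c by rewrite eb.
  exact: (alternating_mid ec eb alt_e alt_at' alt_bv).
(* [g] is smaller than the trees [c] and [b] together, their sizes being positive, so both triples
   below have total size less than [N]. *)
have := fs_gt0 c; have := fs_gt0 b; rewrite fs_cons fs_rcons (fs_cons b) in le_N => b0 c0.
rewrite aE (assoc_lt (bwd [:: a]) (bwd t) bg); last by slia.
by rewrite (assoc_lt (bwd [:: a]) (size_bounded_dia (bwd t) bg) (bwd v)) //; slia.
Qed.

(** For letters this is associativity in [A]. For brackets, each premise of [assoc_at_brk] has lost
    at least one pair of brackets and falls under the induction hypothesis. *)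
Lemma assoc_trees a b d : alternating_tree a -> alternating_tree b ->
  alternating_tree d -> is_br a = is_br b -> is_br b = is_br d ->
  (fs [:: a] + fs [:: b] + fs [:: d] <= N)%N ->
  assoc_at (B [:: a]) (B [:: b]) (B [:: d]).
Proof.
case: a b d => [x|x] [y|y] [z|z] // alt_x alt_y alt_z _ _ le_N.
  by rewrite /assoc_at -!(jA_letter X_basis) -!jA_mul mulrA.
have fsBr u : fs [:: Br u] = (fs u).+1 by rewrite forest_size_Br addn0.
rewrite !fsBr in le_N; rewrite -!brk_wd //.
have bx := bwd x; have by_ := bwd y; have bz := bwd z.
have Px := size_bounded_brk bx; have Py := size_bounded_brk by_.
have Pz := size_bounded_brk bz.
refine (assoc_at_brk _ _ _ _ _ _ _).
- by refine (assoc_lt bx by_ bz _); slia.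
- by refine (assoc_lt Px by_ bz _); slia.
- by refine (assoc_lt bx Py bz _); slia.
- by refine (assoc_lt bx by_ Pz _); slia.
- by refine (assoc_lt Px Py bz _); slia.
- by refine (assoc_lt Px by_ Pz _); slia.
- by refine (assoc_lt bx Py Pz _); slia.
Qed.

(** A change of type between neighbours turns one product into a concatenation. If [a], [b] and the
    head of [r] share a type, splitting off the tail of [r] reduces both sides to [assoc_trees]. *)
Lemma assoc_tree2 a b r : alternating_tree a -> alternating_tree b ->
  alternating r -> (fs [:: a] + fs [:: b] + fs r <= N)%N ->
  assoc_at (B [:: a]) (B [:: b]) (B r).
Proof.
rewrite /assoc_at; move=> alt_a alt_b.
have [ab|ab] := eqVneq (is_br a) (is_br b); last first.
  move=> alt_r le_N; rewrite (dia_concat1 alt_a ab) ?alternating1 //.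
  rewrite assoc_concat // ?alternating_cons2 ?alt_a ?ab ?alternating1 //.
  by rewrite fs_cons.
case: r => [|d r] alt_r le_N; first by rewrite !dia_1r.
have [alt_d alt_r'] := alternating_behead alt_r.
have [bd|bd] := eqVneq (is_br b) (is_br d); last first.
  by rewrite (dia_concat1 alt_b bd alt_r) -dia_split_right // alternating_cons2 alt_b bd.
rewrite (dia_split_right alt_b alt_r).
have [p [g [sp bp bg mulE]]] := dia_same_type ab alt_a alt_b.
have [q [h [sq bq bh mulE']]] := dia_same_type bd alt_b alt_d.
have pE : B [:: a] ⋄ B [:: b] = p + g.
  by have := mulE [::] [::]; rewrite !alternating1 !ctx_nil dia_1l dia_1r; apply.
have qE : B [:: b] ⋄ B [:: d] = q + h.
  by have := mulE' [::] [::]; rewrite !alternating1 !ctx_nil dia_1l dia_1r; apply.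
have := fs_gt0 a; have := fs_gt0 b; have := fs_gt0 d.
rewrite (fs_cons d) in le_N => d0 b0 a0.
(* The merged part [p] consists of single trees, for which [dia_split_right] detaches [r]; the
   remainder [g] is small enough for the induction hypothesis. *)
have -> : (B [:: a] ⋄ B [:: b]) ⋄ B (d :: r) = ((B [:: a] ⋄ B [:: b]) ⋄ B [:: d]) ⋄ B r.
  rewrite pE !diaDl; congr (_ + _); last first.
    by rewrite (dia_cons alt_r) (assoc_lt bg (bwd [:: d]) (bwd r)) //; slia.
  apply: (single_lin_eq (L := fun p => p ⋄ B (d :: r))
    (L' := fun p => (p ⋄ B [:: d]) ⋄ B r) _ _ sp bp).
  - exact: BL.
  - exact: lin_comp (BL _) (BL _).
  by move=> c alt_c _ _; apply: dia_split_right.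
rewrite assoc_trees //; last by slia.
rewrite qE !(diaDr, diaDl); congr (_ + _); last first.
  by rewrite (assoc_lt (bwd [:: a]) bh (bwd r)) //; slia.
apply: (single_lin_eq (L := fun q => (B [:: a] ⋄ q) ⋄ B r)
  (L' := fun q => B [:: a] ⋄ (q ⋄ B r)) _ _ sq bq).
- exact: lin_comp (BL _) (BR _).
- exact: lin_comp (BR _) (BL _).
move=> c alt_c cd _; have alt_cr := alternating_head cd alt_c alt_r.
by rewrite -dia_split_right // -(dia_cons alt_cr).
Qed.

(** If [a] and the head [b] of the second word have the same type, [b] is detached and multiplied
    with [a]; [assoc_tree2] handles these two trees against everything to their right. *)
Lemma assoc_tree a t r : alternating_tree a -> alternating t ->
  alternating r -> (fs [:: a] + fs t + fs r <= N)%N ->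
  assoc_at (B [:: a]) (B t) (B r).
Proof.
rewrite /assoc_at; case: t => [|b t] alt_a alt_t alt_r le_N.
  by rewrite dia_1l dia_1r.
have [alt_b alt_t'] := alternating_behead alt_t.
have [ab|ab] := eqVneq (is_br a) (is_br b); last first.
  rewrite dia_concat1 // assoc_concat //; last by rewrite fs_cons.
  by rewrite alternating_cons2 alt_a ab.
have [t0|t0] := eqVneq t [::]; first by subst t; apply: assoc_tree2.
have [p [g [sp bp bg mulE]]] := dia_same_type ab alt_a alt_b.
have pE : B [:: a] ⋄ B [:: b] = p + g.
  by have := mulE [::] [::]; rewrite !alternating1 !ctx_nil dia_1l dia_1r; apply.
have := fs_gt0 a; have := fs_gt0 b; rewrite (fs_cons b) in le_N => b0 a0.
rewrite (assoc_concat alt_t t0 alt_r); last by rewrite fs_cons; slia.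
have bf := size_bounded_dia (bwd t) (bwd r).
have -> : B [:: a] ⋄ (B [:: b] ⋄ (B t ⋄ B r)) = (B [:: a] ⋄ B [:: b]) ⋄ (B t ⋄ B r).
  apply: (F_lin_eq (L := fun f => B [:: a] ⋄ (B [:: b] ⋄ f))
    (L' := fun f => (B [:: a] ⋄ B [:: b]) ⋄ f)).
  - exact: lin_comp (BR _) (BR _).
  - exact: BR.
  by move=> s alt_s [w /bf ws wE]; rewrite wE in ws; rewrite assoc_tree2 //; slia.
rewrite dia_split_right // pE !diaDl; congr (_ + _); last first.
  by rewrite (assoc_lt bg (bwd t) (bwd r)) //; slia.
apply: (single_lin_eq (L := fun p => (p ⋄ B t) ⋄ B r)
  (L' := fun p => p ⋄ (B t ⋄ B r)) _ _ sp bp).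
- exact: lin_comp (BL _) (BL _).
- exact: BL.
(* Each tree in [p] has the type of [b], hence can precede [t], and [assoc_concat] applies to the
   resulting word. *)
move=> c alt_c cb cN; have alt_ct := alternating_head cb alt_c alt_t.
by rewrite -(dia_cons alt_ct) (assoc_concat alt_ct t0 alt_r) //; rewrite fs_cons; slia.
Qed.

(** The first tree of [s] is moved outside by [assoc_tree]. What is left is associativity for the
    tail of [s] with [t] and [r], of smaller total size. *)
Lemma assoc_words s t r : alternating s -> alternating t -> alternating r ->
  (fs s + fs t + fs r <= N)%N -> assoc_at (B s) (B t) (B r).
Proof.
rewrite /assoc_at; case: s => [|a s] alt_s alt_t alt_r le_N.
  by rewrite !dia_1l.
have [alt_a alt_s'] := alternating_behead alt_s.
have [s0|s0] := eqVneq s [::]; first by subst s; apply: assoc_tree.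
have assoc_treeF m l f g : size_bounded m f -> size_bounded l g ->
    (fs [:: a] + m + l <= N)%N -> (B [:: a] ⋄ f) ⋄ g = B [:: a] ⋄ (f ⋄ g).
  move=> bf bg le_N'; apply: assoc_ext => u v r' alt_u alt_v alt_r'.
  move=> [w /(msupp_wd _)wu wuE] [w' /bf vm wv] [w'' /bg rl wr].
  rewrite -wuE (wu _) ?alternating1 //; rewrite wv wr in vm rl.
  by apply: assoc_tree => //; slia.
have := fs_gt0 a; rewrite fs_cons in le_N => a0.
rewrite dia_cons // (assoc_treeF _ _ _ _ (bwd s) (bwd t)); last by slia.
rewrite (assoc_treeF _ _ _ _ (size_bounded_dia (bwd s) (bwd t)) (bwd r)); last by slia.
rewrite (assoc_treeF _ _ _ _ (bwd s) (size_bounded_dia (bwd t) (bwd r))); last by slia.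
by rewrite (IH alt_s' alt_t alt_r) //; slia.
Qed.

End Step.

Lemma dia_assoc : associative (dia kap : F -> F -> F).
Proof.
have assocB N s t r : alternating s -> alternating t -> alternating r ->
    (fs s + fs t + fs r < N)%N -> assoc_at (B s) (B t) (B r).
  elim: N s t r => // N IHN s t r alt_s alt_t alt_r lt_N.
  exact: (assoc_words IHN).
move=> f g h; apply/esym/assoc_ext => s t r alt_s alt_t alt_r _ _ _.
exact: (assocB _.+1).
Qed.

End Diamond.
(** * Coalgebra structures on a generated algebra *)

Section Generated.
Context {k : comNzRingType}.
Variables (C : lmodType k) (DeltaC : C -> C ⊗ C) (epsC : C -> k^o).
Hypothesis hC : is_coalgebra DeltaC epsC.
Variables (V : lmodType k) (mul : V -> V -> V) (one : V).
Hypothesis hV : is_algebra mul one.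
Variables (P : V -> V) (lam : k) (j : C -> V).
Hypotheses (P_lin : linear P) (j_lin : linear j).
Variables (eps : V -> k^o) (Delta : V -> V ⊗ V).
Hypothesis eps_hom : is_alg_hom mul one *%R (1 : k^o) eps.
Hypothesis eps_P : forall x, eps (P x) = - lam *: eps x.
Hypothesis eps_j : forall a, eps (j a) = epsC a.
Hypothesis Delta_hom :
  is_alg_hom mul one (tensor_mul mul mul) (tens one one) Delta.
Hypothesis Delta_P : forall x, Delta (P x) = tensor_lift (fun u v =>
  tens (P u + lam *: u) (eps v *: one) + tens u (P v)) (Delta x).
Hypothesis Delta_j : forall a, Delta (j a) = tensor_map j j (DeltaC a).
Hypothesis gen_ind : forall S : V -> Prop, is_submodule S ->
  (forall a, S (j a)) -> (forall x y, S x -> S y -> S (mul x y)) ->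
  (forall x, S x -> S (P x)) -> forall x, S x.
Implicit Types (x y u v : V) (t : V ⊗ V).

Let mulB := alg_bilin hV.
Let Delta_lin := hom_linear Delta_hom.
Let eps_lin := hom_linear eps_hom.

(** The elements on which the two maps agree form a submodule to which [gen_ind] applies. *)
Lemma gen_lin_mul_eq (W : lmodType k) (mW : W -> W -> W) (f g : V -> W) :
  linear f -> linear g -> (forall a, f (j a) = g (j a)) ->
  (forall x y, f (mul x y) = mW (f x) (f y)) ->
  (forall x y, g (mul x y) = mW (g x) (g y)) ->
  (forall x, f x = g x -> f (P x) = g (P x)) -> f =1 g.
Proof.
move=> hf hg fj fM gM fP; apply: gen_ind => //; first exact: equalizer_submodule.
by move=> x y fx fy; rewrite fM gM fx fy.
Qed.

Definition counit_right : V ⊗ V -> V := tensor_lift (fun a b => eps b *: a).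
Definition counit_left : V ⊗ V -> V := tensor_lift (fun a b => eps a *: b).

Lemma counit_right_bilin : bilin (fun a b : V => eps b *: a).
Proof.
split=> [u|v]; first exact: lin_scalel.
exact: (lin_scale (eps v) (@lin_id k V)).
Qed.

Lemma counit_left_bilin : bilin (fun a b : V => eps a *: b).
Proof. by split=> [u|v]; [case: counit_right_bilin | case: counit_right_bilin]. Qed.

Lemma counit_right_linear : linear counit_right.
Proof. exact/tensor_lift_linear/counit_right_bilin. Qed.

Lemma counit_left_linear : linear counit_left.
Proof. exact/tensor_lift_linear/counit_left_bilin. Qed.

Lemma counit_rightE u v : counit_right (tens u v) = eps v *: u.
Proof. by rewrite /counit_right tensor_liftE //; apply: counit_right_bilin. Qed.

Lemma counit_leftE u v : counit_left (tens u v) = eps u *: v.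
Proof. by rewrite /counit_left tensor_liftE //; apply: counit_left_bilin. Qed.

Lemma mulZZ a b x y : mul (a *: x) (b *: y) = (a * b) *: mul x y.
Proof.
by rewrite (linZ (lin_bl mulB _)) (linZ (lin_br mulB _)) scalerA.
Qed.

Lemma counit_right_mul t t' :
  counit_right (tensor_mul mul mul t t') = mul (counit_right t) (counit_right t').
Proof.
apply: tensor_lin_mul => //; first exact: counit_right_linear.
by move=> u v u' v'; rewrite !counit_rightE mulZZ (hom_mul eps_hom).
Qed.

Lemma counit_left_mul t t' :
  counit_left (tensor_mul mul mul t t') = mul (counit_left t) (counit_left t').
Proof.
apply: tensor_lin_mul => //; first exact: counit_left_linear.
by move=> u v u' v'; rewrite !counit_leftE mulZZ (hom_mul eps_hom).
Qed.

(** In the first summand of [Delta_P] the counit contracts the right factor, and the right counit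
    law at [x] turns the result into one pure tensor. *)
Lemma Delta_P_split x : counit_right (Delta x) = x ->
  Delta (P x) = tens (P x + lam *: x) one + tensor_map id P (Delta x).
Proof.
move=> cx; rewrite Delta_P; have hB := tens_bilin V V.
have PL : linear (fun u => P u + lam *: u) by apply: lin_add => //; apply: lin_scale.
have oneL : linear (fun v => eps v *: one) by apply: lin_scalel.
have B1 := bilin_comp hB PL oneL; have B2 := bilin_comp hB (@lin_id k V) P_lin.
have lift_bilin : bilin (fun u v => tens (P u + lam *: u) (eps v *: one) + tens u (P v)).
  by split=> [u|v]; apply: lin_add; [case: B1 | case: B2 | case: B1 | case: B2].
(* The two bare [x] on the right become contractions of [Delta x]; both sides are then linear in
   that tensor and can be compared on pure tensors. *)
rewrite -{2 3}cx; move: (Delta x) => t {cx x}; move: t; apply: tensor_lin_eq.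
- exact: tensor_lift_linear.
- apply: lin_add; last exact: tensor_map_linear.
  exact: (lin_comp (lin_bl hB one) (lin_comp PL counit_right_linear)).
move=> u v; rewrite tensor_liftE // tensor_mapE // counit_rightE (linZ PL).
by rewrite tensZl tensZr.
Qed.

(** This law comes first because [Delta_P_split] depends on it. At [P x] the extra term [lam *: x]
    cancels against the second summand, where [eps_P] produces [- lam *: x]. *)
Lemma counit_right_Delta x : counit_right (Delta x) = x.
Proof.
move: x; apply: (gen_lin_mul_eq (mW := mul) (g := id)) => //.
- exact: (lin_comp counit_right_linear Delta_lin).
- move=> a; rewrite Delta_j -[in RHS](coalg_counitr hC a).
  move: (DeltaC a); have hb : bilin (fun a b : C => epsC b *: a).
    split=> [u|v]; first exact: (lin_scalel _ (coalg_eps_linear hC)).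
    exact: (lin_scale (epsC v) (@lin_id k C)).
  apply: tensor_lin_eq.
  + exact: (lin_comp counit_right_linear (tensor_map_linear j_lin j_lin)).
  + exact: (lin_comp j_lin (tensor_lift_linear hb)).
  move=> u v; rewrite tensor_mapE // counit_rightE tensor_liftE //.
  by rewrite (linZ j_lin) eps_j.
- by move=> x y; rewrite (hom_mul Delta_hom) counit_right_mul.
move=> x cx; rewrite (Delta_P_split cx) (linD counit_right_linear) counit_rightE.
rewrite (hom_one eps_hom) scale1r.
have -> : counit_right (tensor_map id P (Delta x)) = - lam *: counit_right (Delta x).
  move: (Delta x); apply: tensor_lin_eq.
  - exact: (lin_comp counit_right_linear (tensor_map_linear (@lin_id k V) P_lin)).
  - exact: lin_scale counit_right_linear.
  by move=> u v; rewrite tensor_mapE // !counit_rightE eps_P scalerA.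
by rewrite cx scaleNr addrK.
Qed.

(** At [P x] the first summand of [Delta_P_split] vanishes because [eps] kills [P x + lam *: x], and
    the second contracts to [P x]. *)
Lemma counit_left_Delta x : counit_left (Delta x) = x.
Proof.
move: x; apply: (gen_lin_mul_eq (mW := mul) (g := id)) => //.
- exact: (lin_comp counit_left_linear Delta_lin).
- move=> a; rewrite Delta_j -[in RHS](coalg_counitl hC a).
  move: (DeltaC a); have hb : bilin (fun a b : C => epsC a *: b).
    split=> [u|v]; last exact: (lin_scalel _ (coalg_eps_linear hC)).
    exact: (lin_scale (epsC u) (@lin_id k C)).
  apply: tensor_lin_eq.
  + exact: (lin_comp counit_left_linear (tensor_map_linear j_lin j_lin)).
  + exact: (lin_comp j_lin (tensor_lift_linear hb)).
  move=> u v; rewrite tensor_mapE // counit_leftE tensor_liftE //.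
  by rewrite (linZ j_lin) eps_j.
- by move=> x y; rewrite (hom_mul Delta_hom) counit_left_mul.
move=> x cx; rewrite (Delta_P_split (counit_right_Delta x)) (linD counit_left_linear) counit_leftE.
rewrite (linD eps_lin) (linZ eps_lin) eps_P scaleNr addNr scale0r add0r.
have -> : counit_left (tensor_map id P (Delta x)) = P (counit_left (Delta x)).
  move: (Delta x); apply: tensor_lin_eq.
  - exact: (lin_comp counit_left_linear (tensor_map_linear (@lin_id k V) P_lin)).
  - exact: (lin_comp P_lin counit_left_linear).
  by move=> u v; rewrite tensor_mapE // !counit_leftE linZ.
by rewrite cx.
Qed.

Local Notation mul2 := (tensor_mul mul mul).
Let mul2B := tensor_mul_bilin mulB mulB.

(** Pure tensors have to be reached at two levels: in the outer tensor, then in its left factor,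
    itself a tensor. *)
Lemma tensor_assoc_mul (x y : V ⊗ V ⊗ V) :
  tensor_assoc (tensor_mul mul2 mul x y) =
  tensor_mul mul mul2 (tensor_assoc x) (tensor_assoc y).
Proof.
have aL := @tensor_assoc_linear k V V V; have mB := tensor_mul_bilin mulB mul2B.
apply: tensor_lin_mul => // t w t' w'.
have tL (z : V) : linear (fun t : V ⊗ V => tensor_assoc (tens t z)).
  exact: (lin_comp aL (lin_bl (tens_bilin _ _) z)).
move: t t'; apply: tensor_bilin_ind => [y'|x'|x1 x2 y' E1 E2|x' y1 y2 E1 E2|u v u' v'].
- by rewrite (lin0 (lin_bl mul2B _)) !(lin0 (tL _)) (lin0 (lin_bl mB _)).
- by rewrite (lin0 (lin_br mul2B _)) !(lin0 (tL _)) (lin0 (lin_br mB _)).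
- by rewrite (linD (lin_bl mul2B _)) !(linD (tL _)) (linD (lin_bl mB _)) E1 E2.
- by rewrite (linD (lin_br mul2B _)) !(linD (tL _)) (linD (lin_br mB _)) E1 E2.
by rewrite !tensor_mulE // !tensor_assocE !tensor_mulE //.
Qed.

Definition Delta_l t : V ⊗ (V ⊗ V) := tensor_assoc (tensor_map Delta id t).
Definition Delta_r t : V ⊗ (V ⊗ V) := tensor_map id Delta t.

Lemma Delta_l_linear : linear Delta_l.
Proof.
exact: (lin_comp (@tensor_assoc_linear k V V V) (tensor_map_linear Delta_lin (@lin_id k V))).
Qed.

Lemma Delta_r_linear : linear Delta_r.
Proof. exact: tensor_map_linear. Qed.

Lemma Delta_lE u v : Delta_l (tens u v) = tensor_assoc (tens (Delta u) v).
Proof. by rewrite /Delta_l tensor_mapE. Qed.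

Lemma Delta_rE u v : Delta_r (tens u v) = tens u (Delta v).
Proof. by rewrite /Delta_r tensor_mapE. Qed.

Lemma Delta_l_mul t t' :
  Delta_l (mul2 t t') = tensor_mul mul mul2 (Delta_l t) (Delta_l t').
Proof.
apply: tensor_lin_mul => //; first exact: tensor_mul_bilin.
  exact: Delta_l_linear.
move=> u v u' v'; rewrite !Delta_lE -tensor_assoc_mul tensor_mulE //.
by rewrite (hom_mul Delta_hom).
Qed.

Lemma Delta_r_mul t t' :
  Delta_r (mul2 t t') = tensor_mul mul mul2 (Delta_r t) (Delta_r t').
Proof.
apply: tensor_lin_mul => //; first exact: tensor_mul_bilin.
  exact: Delta_r_linear.
by move=> u v u' v'; rewrite !Delta_rE tensor_mulE // (hom_mul Delta_hom).
Qed.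

(** Applying [j] to all three factors carries the two iterated coproducts of [C] to those of [V], so
    coassociativity transfers. *)
Lemma coassoc_j a : Delta_l (Delta (j a)) = Delta_r (Delta (j a)).
Proof.
have aL := @tensor_assoc_linear k; have tB := @tens_bilin k.
have DL := coalg_Delta_linear hC; have jj := tensor_map_linear j_lin j_lin.
have jjj := tensor_map_linear j_lin jj; have idC := @lin_id k C.
pose J : C ⊗ (C ⊗ C) -> V ⊗ (V ⊗ V) := tensor_map j (tensor_map j j).
have JE : forall (u : C) (t : C ⊗ C), J (tens u t) = tens (j u) (tensor_map j j t).
  by move=> u t; rewrite /J tensor_mapE.
have El (t : C ⊗ C) : Delta_l (tensor_map j j t) = J (tensor_assoc (tensor_map DeltaC id t)).
  move: t; apply: tensor_lin_eq.
  - exact: (lin_comp Delta_l_linear jj).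
  - exact: (lin_comp jjj (lin_comp (aL _ _ _) (tensor_map_linear DL idC))).
  move=> u v; rewrite !tensor_mapE // Delta_lE Delta_j.
  move: (DeltaC u); apply: tensor_lin_eq.
  - exact: (lin_comp (aL _ _ _) (lin_comp (lin_bl (tB _ _) (j v)) jj)).
  - exact: (lin_comp jjj (lin_comp (aL _ _ _) (lin_bl (tB _ _) v))).
  by move=> p q; rewrite tensor_mapE // !tensor_assocE JE tensor_mapE.
have Er (t : C ⊗ C) : Delta_r (tensor_map j j t) = J (tensor_map id DeltaC t).
  move: t; apply: tensor_lin_eq.
  - exact: (lin_comp Delta_r_linear jj).
  - exact: (lin_comp jjj (tensor_map_linear idC DL)).
  by move=> u v; rewrite !tensor_mapE // Delta_rE Delta_j JE.
by rewrite !Delta_j El Er (coalg_coassoc hC).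
Qed.

(** On the left, [Delta] of [P x + lam *: x] produces the term [T1]; on the right the same term
    comes from [Delta] of a bracketed second factor. What remains is coassociativity at [x] under
    [T2], which applies [P] to the third factor. *)
Lemma coassoc_P x : Delta_l (Delta x) = Delta_r (Delta x) ->
  Delta_l (Delta (P x)) = Delta_r (Delta (P x)).
Proof.
have DP y := Delta_P_split (counit_right_Delta y).
have aL := @tensor_assoc_linear k; have tB := @tens_bilin k.
have idP : linear (tensor_map id P : V ⊗ V -> V ⊗ V) by apply: tensor_map_linear.
have PL : linear (fun u => P u + lam *: u) by apply: lin_add => //; apply: lin_scale.
pose T1 : V ⊗ V -> V ⊗ (V ⊗ V) := tensor_map id (fun v => tens (P v + lam *: v) one).
have T1l : linear (fun v => tens (P v + lam *: v) one).
  exact: (lin_comp (lin_bl (tB _ _) one) PL).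
have T1L : linear T1 by apply: tensor_map_linear.
pose T2 : V ⊗ (V ⊗ V) -> V ⊗ (V ⊗ V) := tensor_map id (tensor_map id P).
have T2L : linear T2 by apply: tensor_map_linear.
have Er t : Delta_r (tensor_map id P t) = T1 t + T2 (Delta_r t).
  move: t; apply: tensor_lin_eq.
  - exact: (lin_comp Delta_r_linear idP).
  - exact: (lin_add T1L (lin_comp T2L Delta_r_linear)).
  move=> u v; rewrite tensor_mapE // !Delta_rE DP tensDr.
  by rewrite /T1 /T2 !tensor_mapE.
have El t : Delta_l (tensor_map id P t) = T2 (Delta_l t).
  move: t; apply: tensor_lin_eq.
  - exact: (lin_comp Delta_l_linear idP).
  - exact: (lin_comp T2L Delta_l_linear).
  move=> u v; rewrite tensor_mapE // !Delta_lE.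
  move: (Delta u); apply: tensor_lin_eq.
  - exact: (lin_comp (aL _ _ _) (lin_bl (tB _ _) (P v))).
  - exact: (lin_comp T2L (lin_comp (aL _ _ _) (lin_bl (tB _ _) v))).
  by move=> p q; rewrite !tensor_assocE /T2 !tensor_mapE.
have E1 t : tensor_assoc (tens (tensor_map id P t + lam *: t) one) = T1 t.
  move: t; apply: tensor_lin_eq => //.
    apply: (lin_comp (aL _ _ _) (lin_comp (lin_bl (tB _ _) one) _)).
    by apply: lin_add => //; apply: lin_scale.
  move=> u v; rewrite tensor_mapE // -tensZr -tensDr tensor_assocE.
  by rewrite /T1 tensor_mapE.
move=> cx; rewrite (DP x) (linD Delta_l_linear) (linD Delta_r_linear) El Er cx.
rewrite addrA; congr (_ + _); rewrite Delta_lE Delta_rE (hom_one Delta_hom).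
rewrite (linD Delta_lin) (linZ Delta_lin) (DP x) -addrA [tens (tens _ _ + _) _]tensDl.
by rewrite (linD (aL V V V)) tensor_assocE E1.
Qed.

Lemma generated_is_coalgebra : is_coalgebra Delta eps.
Proof.
split=> //; last exact: counit_right_Delta; last exact: counit_left_Delta.
apply: (gen_lin_mul_eq (mW := tensor_mul mul mul2) (f := fun x => Delta_l (Delta x))
  (g := fun x => Delta_r (Delta x))).
- exact: (lin_comp Delta_l_linear Delta_lin).
- exact: (lin_comp Delta_r_linear Delta_lin).
- exact: coassoc_j.
- by move=> x y; rewrite (hom_mul Delta_hom) Delta_l_mul.
- by move=> x y; rewrite (hom_mul Delta_hom) Delta_r_mul.
exact: coassoc_P.
Qed.

End Generated.

(** * Filtrations and antipodes *)

Section Span.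
Context {k : comNzRingType} (V : lmodType k).
Implicit Types (Y S : set V) (v : V).

Lemma span_sub Y : Y `<=` span Y.
Proof.
move=> v Yv; exists [:: v], (fun=> 1); split; last by rewrite big_seq1 scale1r.
by move=> x; rewrite inE => /eqP->.
Qed.

(** A combination in [span] may repeat a vector, with the same coefficient each time. Grouping
    repetitions lets two combinations be added over a common duplicate-free list. *)
Lemma big_undup_count (s t : seq V) (c : V -> k) : {subset s <= t} ->
  \sum_(x <- s) c x *: x = \sum_(x <- undup t) (c x *+ count_mem x s) *: x.
Proof.
elim: s => [|y s IHs] st; first by rewrite big_nil big1 // => x _; rewrite mulr0n scale0r.
have yt : y \in undup t by rewrite mem_undup st ?mem_head.
rewrite big_cons IHs => [|x xs]; last by rewrite st // inE xs orbT.
rewrite [RHS](eq_bigr (fun x => (if x == y then c y *: y else 0) + (c x *+ count_mem x s) *: x)).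
  rewrite big_split -big_mkcond -big_filter (filter_pred1_uniq (undup_uniq _) yt) /=.
  by rewrite big_seq1.
move=> x _ /=; rewrite (eq_sym y); case: eqP => [->|_] /=; last by rewrite add0n add0r.
by rewrite mulrnDr scalerDl.
Qed.

Lemma span_submodule Y : is_submodule (span Y).
Proof.
split=> [|u v [s [c [sY ->]]] [t [d [tY ->]]]|a v [s [c [sY ->]]]].
- by exists [::], (fun=> 0); split; rewrite ?big_nil.
- exists (undup (s ++ t)), (fun x => c x *+ count_mem x s + d x *+ count_mem x t).
  split; first by move=> x; rewrite mem_undup mem_cat => /orP[/sY|/tY].
  rewrite (@big_undup_count s (s ++ t)) => [|x xs]; last by rewrite mem_cat xs.
  rewrite (@big_undup_count t (s ++ t)) => [|x xs]; last by rewrite mem_cat xs orbT.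
  by rewrite -big_split; apply: eq_bigr => x _; rewrite scalerDl.
- exists s, (fun x => a * c x); split=> //.
  by rewrite scaler_sumr; apply: eq_bigr => x _; rewrite scalerA.
Qed.

Lemma submodule_sum S I (r : seq I) (Q : pred I) (F : I -> V) : is_submodule S ->
  (forall i, Q i -> S (F i)) -> S (\sum_(i <- r | Q i) F i).
Proof. by move=> [S0 SD _] SF; apply: big_ind. Qed.

Lemma span_ind Y S : is_submodule S -> Y `<=` S -> span Y `<=` S.
Proof.
move=> hS YS _ [s [c [sY ->]]]; rewrite big_seq; apply: submodule_sum => // x /sY Yx.
by have [_ _ SZ] := hS; apply/SZ/YS.
Qed.

End Span.

Lemma preim_submodule (k : comNzRingType) (U V : lmodType k) (f : U -> V) (S : set V) :
  linear f -> is_submodule S -> is_submodule (fun x => S (f x)).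
Proof.
move=> hf [S0 SD SZ]; split=> [|u v fu fv|a v fv]; first by rewrite lin0.
  by rewrite linD //; apply: SD.
by rewrite linZ //; apply: SZ.
Qed.

Section Filtration.
Context {k : comNzRingType}.

Lemma filtration_le (T : Type) (Vn : nat -> set T) :
  (forall n, Vn n `<=` Vn n.+1) -> forall m n, (m <= n)%N -> Vn m `<=` Vn n.
Proof.
move=> VS m n /subnK<-; elim: (n - m)%N => [//|d IHd] x /IHd /VS.
by rewrite addSn.
Qed.

Lemma tensor_filtration_submodule (V : lmodType k) (Vn : nat -> set V) n :
  is_submodule (tensor_filtration Vn n).
Proof. exact: span_submodule. Qed.

Lemma tensor_filtration_tens (V : lmodType k) (Vn : nat -> set V) p q a b :
  Vn p a -> Vn q b -> tensor_filtration Vn (p + q)%N (tens a b).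
Proof. by move=> pa qb; apply: span_sub; exists p, q, a, b. Qed.

Lemma tensor_filtration_map (U V : lmodType k) (Un : nat -> set U)
    (Vn : nat -> set V) (f g : U -> V) c d : linear f -> linear g ->
  (forall n x, Un n x -> Vn (n + c)%N (f x)) ->
  (forall n x, Un n x -> Vn (n + d)%N (g x)) ->
  forall n t, tensor_filtration Un n t ->
    tensor_filtration Vn (n + (c + d))%N (tensor_map f g t).
Proof.
move=> hf hg fV gV n; apply: span_ind.
  apply: (preim_submodule (tensor_map_linear hf hg)).
  exact: tensor_filtration_submodule.
move=> _ [p [q [a [b [<- pa qb ->]]]]]; rewrite /= tensor_mapE // addnACA.
by apply: tensor_filtration_tens; [apply: fV | apply: gV].
Qed.

Lemma tensor_filtration_mul (V : lmodType k) (Vn : nat -> set V) mul :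
  bilin mul ->
  (forall p q x y, Vn p x -> Vn q y -> Vn (p + q)%N (mul x y)) ->
  forall n m t t', tensor_filtration Vn n t -> tensor_filtration Vn m t' ->
    tensor_filtration Vn (n + m)%N (tensor_mul mul mul t t').
Proof.
move=> hm Vm n m t t' tn; have hmm := tensor_mul_bilin hm hm.
move: t'; apply: span_ind.
  apply: (preim_submodule (lin_br hmm t)); exact: tensor_filtration_submodule.
move=> _ [p' [q' [a' [b' [<- pa' qb' ->]]]]]; move: t tn; apply: span_ind.
  apply: (preim_submodule (lin_bl hmm (tens a' b'))).
  exact: tensor_filtration_submodule.
move=> _ [p [q [a [b [<- pa qb ->]]]]]; rewrite /= tensor_mulE // addnACA.
by apply: tensor_filtration_tens; apply: Vm.
Qed.

End Filtration.

(** * Convolution and the antipode of a connected filtered bialgebra *)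

Section Antipode.
Context {k : comNzRingType} {V : lmodType k} {mul : V -> V -> V} {one : V}.
Context {Delta : V -> V ⊗ V} {eps : V -> k^o} {Vn : nat -> set V}.
Hypothesis hV : is_connected_filtered_bialgebra mul one Delta eps Vn.
Implicit Types (x y a b : V) (f g h : V -> V).

Let hF := proj1 hV.
Let hC := proj2 hV.
Let hB := filt_bialgebra hF.
Let mulB := alg_bilin (bialg_algebra hB).
Let Delta_lin := hom_linear (bialg_Delta hB).
Let eps_lin := hom_linear (bialg_eps hB).

Definition conv_t f g : V ⊗ V -> V := tensor_lift (fun a b => mul (f a) (g b)).
Definition conv f g x : V := conv_t f g (Delta x).

Lemma conv_t_bilin f g : linear f -> linear g -> bilin (fun a b => mul (f a) (g b)).
Proof. exact: bilin_comp. Qed.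

Lemma conv_t_linear f g : linear f -> linear g -> linear (conv_t f g).
Proof. by move=> hf hg; apply/tensor_lift_linear/conv_t_bilin. Qed.

Lemma conv_tE f g a b : linear f -> linear g -> conv_t f g (tens a b) = mul (f a) (g b).
Proof. by move=> hf hg; rewrite /conv_t tensor_liftE //; apply: conv_t_bilin. Qed.

Lemma conv_linear f g : linear f -> linear g -> linear (conv f g).
Proof. by move=> hf hg; apply: lin_comp Delta_lin; apply: conv_t_linear. Qed.

Lemma eq_conv f f' g g' : f =1 f' -> g =1 g' -> conv f g =1 conv f' g'.
Proof. by move=> ff' gg' x; apply: eq_bigr => p _; rewrite ff' gg'. Qed.

Lemma conv_Dl f f' g x : conv (fun y => f y + f' y) g x = conv f g x + conv f' g x.
Proof.
rewrite /conv /conv_t /tensor_lift -big_split /=; apply: eq_bigr => p _.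
by rewrite (linD (lin_bl mulB _)).
Qed.

Lemma conv_Dr f g g' x : conv f (fun y => g y + g' y) x = conv f g x + conv f g' x.
Proof.
rewrite /conv /conv_t /tensor_lift -big_split /=; apply: eq_bigr => p _.
by rewrite (linD (lin_br mulB _)).
Qed.

Lemma conv_Nl f g x : conv (fun y => - f y) g x = - conv f g x.
Proof.
rewrite /conv /conv_t /tensor_lift -sumrN /=; apply: eq_bigr => p _.
by rewrite -scaleN1r (linZ (lin_bl mulB _)) scaleN1r.
Qed.

Lemma conv_Nr f g x : conv f (fun y => - g y) x = - conv f g x.
Proof.
rewrite /conv /conv_t /tensor_lift -sumrN /=; apply: eq_bigr => p _.
by rewrite -scaleN1r (linZ (lin_br mulB _)) scaleN1r.
Qed.

Lemma convA f g h : linear f -> linear g -> linear h ->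
  conv (conv f g) h =1 conv f (conv g h).
Proof.
move=> hf hg hh x; have [fg gh] := (conv_t_linear hf hg, conv_t_linear hg hh).
have tB := @tens_bilin k; have aL := @tensor_assoc_linear k V V V.
have M3B : bilin (fun a s => mul (f a) (conv_t g h s)) by apply: bilin_comp.
(* [M3] multiplies three factors after applying [f], [g] and [h]; the two convolutions are its
   values on the two iterated coproducts. *)
pose M3 : V ⊗ (V ⊗ V) -> V := tensor_lift (fun a s => mul (f a) (conv_t g h s)).
have M3L : linear M3 by apply: tensor_lift_linear.
have M3E a s : M3 (tens a s) = mul (f a) (conv_t g h s) by rewrite /M3 tensor_liftE.
have idL := @lin_id k V; have fgL := conv_linear hf hg; have ghL := conv_linear hg hh.
have E1 : conv_t f (conv g h) (Delta x) = M3 (tensor_map id Delta (Delta x)).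
  move: (Delta x); apply: tensor_lin_eq.
  - exact: conv_t_linear.
  - exact: (lin_comp M3L (tensor_map_linear idL Delta_lin)).
  by move=> a b; rewrite conv_tE // tensor_mapE // M3E.
have E2 : conv_t (conv f g) h (Delta x) =
    M3 (tensor_assoc (tensor_map Delta id (Delta x))).
  move: (Delta x); apply: tensor_lin_eq.
  - exact: conv_t_linear.
  - exact: (lin_comp M3L (lin_comp aL (tensor_map_linear Delta_lin idL))).
  move=> a b; rewrite conv_tE // tensor_mapE // /conv.
  move: (Delta a); apply: tensor_lin_eq.
  - exact: (lin_comp (lin_bl mulB _) fg).
  - exact: (lin_comp M3L (lin_comp aL (lin_bl (tB _ _) b))).
  move=> c d; rewrite conv_tE // tensor_assocE M3E conv_tE //.
  by rewrite (alg_mulA (bialg_algebra hB)).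
rewrite [LHS]E2 [RHS]E1; congr M3; exact: coalg_coassoc (bialg_coalgebra hB) x.
Qed.

Definition conv_unit x : V := eps x *: one.
(* conv_unit - id, which kills the unit and is therefore locally nilpotent for
   the convolution product; the antipode is its geometric series. *)
Definition conv_q x : V := conv_unit x - x.

Lemma conv_unit_linear : linear conv_unit.
Proof. exact: lin_scalel. Qed.

Lemma conv_q_linear : linear conv_q.
Proof.
apply: lin_add conv_unit_linear _ => a x y.
by rewrite opprD scalerN.
Qed.

Lemma conv_unitl f : linear f -> conv conv_unit f =1 f.
Proof.
move=> hf x; rewrite -[in RHS](coalg_counitl (bialg_coalgebra hB) x).
have hb : bilin (fun a b => eps a *: b).
  by split=> [u|v]; [apply: lin_scale | apply: lin_scalel].
rewrite /conv; move: (Delta x); apply: tensor_lin_eq.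
- exact: conv_t_linear conv_unit_linear hf.
- exact: (lin_comp hf (tensor_lift_linear hb)).
move=> a b; rewrite conv_tE //; last exact: conv_unit_linear.
rewrite tensor_liftE // (linZ hf) /conv_unit (linZ (lin_bl mulB _)).
by rewrite (alg_mul1l (bialg_algebra hB)).
Qed.

Lemma conv_unitr f : linear f -> conv f conv_unit =1 f.
Proof.
move=> hf x; rewrite -[in RHS](coalg_counitr (bialg_coalgebra hB) x).
have hb : bilin (fun a b => eps b *: a).
  by split=> [u|v]; [apply: lin_scalel | apply: lin_scale].
rewrite /conv; move: (Delta x); apply: tensor_lin_eq.
- exact: conv_t_linear hf conv_unit_linear.
- exact: (lin_comp hf (tensor_lift_linear hb)).
move=> a b; rewrite conv_tE //; last exact: conv_unit_linear.
rewrite tensor_liftE // (linZ hf) /conv_unit (linZ (lin_br mulB _)).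
by rewrite (alg_mul1r (bialg_algebra hB)).
Qed.

Lemma conv_q0 x : Vn 0%N x -> conv_q x = 0.
Proof.
rewrite (conn_unit hC) => -[a _ <-]; rewrite /conv_q /conv_unit (linZ eps_lin).
by rewrite (hom_one (bialg_eps hB)) [_ *: 1]mulr1 subrr.
Qed.

Fixpoint conv_pow n : V -> V :=
  if n is n'.+1 then conv (conv_pow n') conv_q else conv_unit.

Lemma conv_pow_linear n : linear (conv_pow n).
Proof.
elim: n => [|n IHn]; first exact: conv_unit_linear.
exact: conv_linear IHn conv_q_linear.
Qed.

(** Powers are built by convolving on the right, whereas the right antipode identity needs the
    factor on the left. *)
Lemma conv_powSr n : conv conv_q (conv_pow n) =1 conv_pow n.+1.
Proof.
elim: n => [|n IHn] x /=.
  by rewrite conv_unitr ?conv_unitl //; apply: conv_q_linear.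
rewrite -convA; try exact: conv_q_linear; last exact: conv_pow_linear.
exact: eq_conv.
Qed.

Lemma Vn_le m n : (m <= n)%N -> Vn m `<=` Vn n.
Proof. exact: filtration_le (filt_increasing hF) _ _. Qed.

(** The coproduct of an element of step [n.+1] is a sum of tensors of degrees [p + q = n.+1]. If [q]
    is 0, [conv_q] kills the right factor; otherwise [p] is at most [n] and the power already kills
    the left one. *)
Lemma conv_pow_nilp n x : Vn n x -> conv_pow n.+1 x = 0.
Proof.
elim: n x => [|n IHn] x Vx.
  by rewrite /= conv_unitl; [apply: conv_q0 | apply: conv_q_linear].
have pL := conv_pow_linear n.+1; have qL := conv_q_linear.
have pq0 : tensor_filtration Vn n.+1 `<=` (fun t => conv_t (conv_pow n.+1) conv_q t = 0).
  apply: span_ind; first exact: equalizer_submodule (conv_t_linear pL qL) (@lin_cst0 k _ _).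
  move=> _ [p [q [a [b [pq pa qb ->]]]]].
  change (conv_t (conv_pow n.+1) conv_q (tens a b) = 0); rewrite conv_tE //.
  case: q pq qb => [|q] pq qb.
    by rewrite (conv_q0 qb) (lin0 (lin_br mulB _)).
  rewrite IHn ?(lin0 (lin_bl mulB _)) //; apply: Vn_le pa.
  by move: pq; rewrite addnS => -[<-]; apply: leq_addr.
exact: pq0 (filt_Delta hF Vx).
Qed.

Definition conv_geom n x : V := \sum_(i < n) conv_pow i x.

Lemma conv_geom_linear n : linear (conv_geom n).
Proof.
move=> a x y; rewrite /conv_geom scaler_sumr -big_split; apply: eq_bigr => i _.
exact: conv_pow_linear.
Qed.

Lemma conv_geomS n x : conv_geom n.+1 x = conv_geom n x + conv_pow n x.
Proof. exact: big_ord_recr. Qed.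

Lemma id_conv_q x : x = conv_unit x - conv_q x.
Proof. by rewrite /conv_q opprB addrC subrK. Qed.

(** Writing the identity as [conv_unit] minus [conv_q] makes the sum telescope. *)
Lemma conv_geom_idl n x : conv (conv_geom n) id x = conv_unit x - conv_pow n x.
Proof.
elim: n => [|n IHn].
  rewrite subrr /conv /conv_t /tensor_lift big1 // => p _.
  by rewrite /conv_geom big_ord0 (lin0 (lin_bl mulB _)).
rewrite (eq_conv (conv_geomS n) (frefl id)) conv_Dl IHn.
rewrite (eq_conv (frefl (conv_pow n)) id_conv_q) conv_Dr conv_Nr.
by rewrite conv_unitr ?addrA ?subrK //; apply: conv_pow_linear.
Qed.

Lemma conv_geom_idr n x : conv id (conv_geom n) x = conv_unit x - conv_pow n x.
Proof.
elim: n => [|n IHn].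
  rewrite subrr /conv /conv_t /tensor_lift big1 // => p _.
  by rewrite /conv_geom big_ord0 (lin0 (lin_br mulB _)).
rewrite (eq_conv (frefl id) (conv_geomS n)) conv_Dr IHn.
rewrite (eq_conv id_conv_q (frefl (conv_pow n))) conv_Dl conv_Nl conv_powSr.
by rewrite conv_unitl ?addrA ?subrK //; apply: conv_pow_linear.
Qed.

Lemma conv_geom_stable n m x : Vn n x -> (n <= m)%N ->
  conv_geom m.+1 x = conv_geom n.+1 x.
Proof.
move=> Vx /subnK<-; elim: (m - n)%N => // d IHd.
rewrite addSn conv_geomS IHd conv_pow_nilp ?addr0 //.
by apply: Vn_le Vx; apply: leq_addl.
Qed.

(** Some index of a step containing [x], not necessarily the least. The default 0 is never reached,
    the filtration being exhaustive. *)
Definition filt_deg x : nat := xget 0%N [set n | Vn n x].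

Lemma filt_degP x : Vn (filt_deg x) x.
Proof.
rewrite /filt_deg; case: xgetP => [n -> //|noVx].
have : (\bigcup_n Vn n) x by rewrite (filt_exhaustive hF).
by move=> [n _ Vx]; case: (noVx n).
Qed.

Definition antipode x : V := conv_geom (filt_deg x).+1 x.

(** The later terms of the series vanish on [x], so the choice made by [filt_deg] does not
    matter. *)
Lemma antipodeE n x : Vn n x -> antipode x = conv_geom n.+1 x.
Proof.
move=> Vx; have Vdx := filt_degP x.
by rewrite -(conv_geom_stable Vx (leq_maxl n (filt_deg x)))
  (conv_geom_stable Vdx (leq_maxr n (filt_deg x))).
Qed.

Lemma antipode_linear : linear antipode.
Proof.
move=> a x y; pose n := maxn (filt_deg x) (filt_deg y).
have Vx : Vn n x by apply: Vn_le (filt_degP x); apply: leq_maxl.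
have Vy : Vn n y by apply: Vn_le (filt_degP y); apply: leq_maxr.
have [_ VD VZ] := filt_submodule hF n.
rewrite (antipodeE Vx) (antipodeE Vy) (antipodeE (VD _ _ (VZ a x Vx) Vy)).
exact: conv_geom_linear.
Qed.

Lemma connected_filtered_antipode : is_antipode mul one Delta eps antipode.
Proof.
have sL := antipode_linear; have idL := @lin_id k V; split=> // x.
  rewrite -/(conv antipode id x) -/(conv_unit x); have Vx := filt_degP x.
  set n := filt_deg x in Vx; have gL := conv_geom_linear n.+1.
  rewrite -[RHS]subr0 -(conv_pow_nilp Vx) -conv_geom_idl.
  (* Both factors of a pure tensor in this filtration lie in step [n], so one fixed truncation
     replaces [antipode]. *)
  have agree : tensor_filtration Vn n `<=`
      (fun t => conv_t antipode id t = conv_t (conv_geom n.+1) id t).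
    apply: span_ind; first by apply: equalizer_submodule; apply: conv_t_linear.
    move=> _ [p [q [a [b [pq pa qb ->]]]]].
    change (conv_t antipode id (tens a b) = conv_t (conv_geom n.+1) id (tens a b)).
    by rewrite !conv_tE // (@antipodeE n) //; apply: Vn_le pa; rewrite -pq leq_addr.
  exact: agree (filt_Delta hF Vx).
rewrite -/(conv id antipode x) -/(conv_unit x); have Vx := filt_degP x.
set n := filt_deg x in Vx; have gL := conv_geom_linear n.+1.
rewrite -[RHS]subr0 -(conv_pow_nilp Vx) -conv_geom_idr.
have agree : tensor_filtration Vn n `<=`
    (fun t => conv_t id antipode t = conv_t id (conv_geom n.+1) t).
  apply: span_ind; first by apply: equalizer_submodule; apply: conv_t_linear.
  move=> _ [p [q [a [b [pq pa qb ->]]]]].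
  change (conv_t id antipode (tens a b) = conv_t id (conv_geom n.+1) (tens a b)).
  by rewrite !conv_tE // (@antipodeE n) //; apply: Vn_le qb; rewrite -pq leq_addl.
exact: agree (filt_Delta hF Vx).
Qed.

End Antipode.

(** * The filtration by weight *)

Lemma malg_submodule (k : comNzRingType) (K : choiceType) (V : lmodType k)
    (S : set V) (L : {malg k[K]} -> V) f : is_submodule S -> linear L ->
  (forall w, w \in msupp f -> S (L << w >>)) -> S (L f).
Proof.
move=> hS hL SL; rewrite (malg_basisE f) (lin_sum hL) big_seq.
apply: submodule_sum => // w /SL; rewrite (linZ hL).
by have [_ _ SZ] := hS; apply: SZ.
Qed.

(** * Generation of F(A) by j(A) and the bracket *)

Section Generation.
Context {k : comNzRingType} {A : algType k} (X : set A) (kap : k).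
Hypotheses (X_basis : is_basis X) (X1 : X 1).
Local Notation F := (FA X).

Lemma alternating_ind (Q : seq (tree (letter X)) -> Prop) : Q [::] ->
  (forall l, Q [:: Leaf l]) ->
  (forall s, alternating s -> Q s -> Q [:: Br s]) ->
  (forall a s, alternating (a :: s) -> Q [:: a] -> Q s -> Q (a :: s)) ->
  forall s, alternating s -> Q s.
Proof.
move=> Q0 QL QB Qcons s; have [n] := ubnP (forest_size s).
elim: n s => // n IHn [|a s] // lt_n alt_as; have [alt_a alt_s] := alternating_behead alt_as.
have Qa : Q [:: a].
  case: a lt_n alt_a {alt_as} => [l|x] lt_n alt_x; first exact: QL.
  by apply: (QB _ alt_x); apply: IHn => //; move: lt_n; rewrite forest_size_Br; slia.
apply: Qcons => //; apply: IHn => //.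
by rewrite fs_cons in lt_n; move: (fs_gt0 a); slia.
Qed.

Lemma F_gen_ind (S : set F) : is_submodule S -> (forall a, S (jA X a)) ->
  (forall f g, S f -> S g -> S (dia kap f g)) -> (forall f, S f -> S (brk f)) ->
  forall f, S f.
Proof.
move=> hS Sj SM SP f; apply: (malg_submodule (S := S) (L := id)) => // w _.
rewrite -wd_val; apply: (alternating_ind (Q := fun s => S (wd s))); last exact: valP.
- by rewrite -(jA1 X_basis X1).
- by move=> l; rewrite -(jA_letter X_basis).
- by move=> s alt_s Ss; rewrite -brk_wd //; apply: SP.
by move=> a s alt_as Sa Ss; rewrite (dia_cons kap alt_as); apply: SM.
Qed.

End Generation.

Section Weights.
Context {T : Type} (d : T -> nat).

Fixpoint tree_weight (t : tree T) : nat :=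
  match t with
  | Leaf x => d x
  | Br s => (sumn (map tree_weight s)).+1
  end.

Definition weight (s : seq (tree T)) : nat := sumn (map tree_weight s).

Lemma weight_cat s t : weight (s ++ t) = (weight s + weight t)%N.
Proof. by rewrite /weight map_cat sumn_cat. Qed.

Lemma weight_Br s : weight [:: Br s] = (weight s).+1.
Proof. by rewrite /weight /= addn0. Qed.

Lemma weight_Leaf x : weight [:: Leaf x] = d x.
Proof. by rewrite /weight /= addn0. Qed.

End Weights.

(** * Weights of words and multiplicativity of the filtration *)

Section WordFiltration.
Context {k : comNzRingType} {A : algType k} (X : set A) (kap : k).
Variables (An Xn : nat -> set A).
Hypotheses (X_basis : is_basis X) (X1 : X 1).
Hypotheses (Xn_incr : forall n, Xn n `<=` Xn n.+1) (XnE : X = \bigcup_n Xn n).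
Hypotheses (An_span : forall n, An n = span (Xn n)) (Xn0 : Xn 0%N = [set 1]).
Hypothesis An_mul : forall p q x y, An p x -> An q y -> An (p + q)%N (x * y).
Local Notation F := (FA X).
Local Notation tr := (tree (letter X)).
Local Notation B := (@wd k A X).
Local Notation P := (@brk k A X).
Local Notation fs := (@forest_size (letter X)).
Local Notation "f ⋄ g" := (dia kap f g) (at level 40, left associativity).
Implicit Types (s t u v : seq tr) (f g : F).

(* 0 if x is in no X_n. *)
Definition letter_deg (x : A) : nat :=
  xget 0%N [set n | Xn n x /\ forall m, Xn m x -> (n <= m)%N].

Lemma letter_degP x n : X x -> (letter_deg x <= n)%N <-> Xn n x.
Proof.
move=> Xx; have [m Xm m_min] : exists2 m, Xn m x & forall i, Xn i x -> (m <= i)%N.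
  have exX : exists m, `[< Xn m x >].
    by move: Xx; rewrite XnE => -[m _ Xm]; exists m; apply/asboolP.
  exists (ex_minn exX); case: ex_minnP => m /asboolP // _ m_min i Xi.
  by apply: m_min; apply/asboolP.
have -> : letter_deg x = m.
  rewrite /letter_deg; case: xgetP => [i -> [Xi i_min]|/(_ m)]; last by case.
  by apply/eqP; rewrite eqn_leq i_min // m_min.
split=> [mn|]; last exact: m_min.
exact: (filtration_le Xn_incr mn).
Qed.

Local Notation wt := (weight (fun l : letter X => letter_deg (val l))).

Lemma wt_cons a v : wt (a :: v) = (wt [:: a] + wt v)%N.
Proof. by rewrite -cat1s weight_cat. Qed.

Lemma wt_lword z n : Xn n z -> (wt (lword X z) <= n)%N.
Proof.
move=> Xz; have Xz' : X z by rewrite XnE; exists n.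
have [->|z1] := eqVneq z 1; first by rewrite lword1.
have [l lz ->] := lword_letter Xz' z1.
by rewrite weight_Leaf lz; apply/letter_degP.
Qed.

(** A letter differs from 1, the only element of [Xn 0], so it weighs at least 1, as does a bracket.
    Connectedness rests on this. *)
Lemma wt_eq0 s : wt s = 0%N -> s = [::].
Proof.
case: s => // a s; rewrite wt_cons => /eqP; rewrite addn_eq0 => /andP[+ _].
case: a => [l|x]; last by rewrite weight_Br.
have [Xl l1] := letterP l; rewrite weight_Leaf -leqn0 => /letter_degP-/(_ Xl).
by rewrite Xn0 => l1'; rewrite l1' eqxx in l1.
Qed.

Definition Fn (n : nat) : set F :=
  [set f | forall w, w \in msupp f -> (wt (val w) <= n)%N].

Lemma Fn_submodule n : is_submodule (Fn n).
Proof.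
split=> [w|f g nf ng w /(fsubsetP (msuppD_le _ _))|a f nf w /(fsubsetP (msuppZ_le _ _))].
- by rewrite msupp0.
- by rewrite in_fsetU => /orP[/nf|/ng].
- exact: nf.
Qed.

Lemma Fn_le m n : (m <= n)%N -> Fn m `<=` Fn n.
Proof. by move=> mn f mf w /mf wm; apply: leq_trans mn. Qed.

Lemma Fn_wd s n : alternating s -> (wt s <= n)%N -> Fn n (B s).
Proof. by move=> alt_s sn w /(msupp_wd alt_s) ->. Qed.

Lemma Fn_lin (V : lmodType k) (S : set V) (L : F -> V) n f :
  is_submodule S -> linear L ->
  (forall s, alternating s -> (wt s <= n)%N -> S (L (B s))) -> Fn n f -> S (L f).
Proof.
move=> hS hL SL nf; apply: (malg_submodule (S := S) (L := L)) => // w wf.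
by rewrite -wd_val; apply: SL; [apply: valP | apply: nf].
Qed.

Lemma Fn_brk n f : Fn n f -> Fn n.+1 (P f).
Proof.
apply: (Fn_lin (S := Fn n.+1) (L := P)); [exact: Fn_submodule | exact: (@brk_linear k A X) |].
move=> s alt_s sn; rewrite (brk_wd alt_s); apply: Fn_wd.
  by rewrite alternating_Br.
by rewrite weight_Br.
Qed.

(** It suffices to treat the spanning set [Xn n] of [An n], where each vector is its own
    expansion. *)
Lemma coords_Xn n a : An n a -> forall z, z \in msupp (coords X a) -> Xn n z.
Proof.
rewrite An_span; move: a; apply: span_ind.
  split=> [z|a b na nb z|c a na z].
  - by rewrite (lin0 (coords_linear X_basis)) msupp0.
  - rewrite (linD (coords_linear X_basis)) => /(fsubsetP (msuppD_le _ _)).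
    by rewrite in_fsetU => /orP[/na|/nb].
  - by rewrite (linZ (coords_linear X_basis)) => /(fsubsetP (msuppZ_le _ _))/na.
move=> x Xx z; rewrite (coords_basis X_basis); last by rewrite XnE; exists n.
by rewrite msuppU oner_eq0 in_fset1 => /eqP->.
Qed.

Lemma An_letter (l : letter X) : An (wt [:: Leaf l]) (val l).
Proof.
have [Xl _] := letterP l; rewrite An_span weight_Leaf; apply: span_sub.
exact/letter_degP.
Qed.

Lemma Fn_jA n a : An n a -> Fn n (jA X a).
Proof.
move=> na; rewrite -jAE /j_A /lin_ext big_seq wdE lwordE.
apply: (submodule_sum _ (Fn_submodule n)) => z /(coords_Xn na) Xz.
have [_ _ FZ] := Fn_submodule n; apply/FZ/Fn_wd; last exact: wt_lword.
have Xz' : X z by rewrite XnE; exists n.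
have [->|z1] := eqVneq z 1; first by rewrite lword1.
by have [l _ ->] := lword_letter Xz' z1.
Qed.

(* [basis_word s] is junk for a sequence s that is not alternating, but then it
   is the empty word, of weight 0. *)
Lemma Fn_wd_junk s n : (wt s <= n)%N -> Fn n (B s).
Proof.
move=> sn w; rewrite -wdE /basis_word => /(fsubsetP msuppU_le).
rewrite in_fset1 => /eqP->; apply: leq_trans sn.
by rewrite /mkword /insubd; case: insubP => //= w' _ ->.
Qed.

Lemma Fn_ctx u v n f : Fn n f -> Fn (wt u + n + wt v)%N (ctx u v f).
Proof.
apply: (Fn_lin (S := Fn (wt u + n + wt v)) (L := ctx u v)); [exact: Fn_submodule | exact: ctx_linear |].
move=> s alt_s sn; rewrite (ctx_wd _ _ alt_s); apply: Fn_wd_junk.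
by rewrite !weight_cat -addnA leq_add2l leq_add2r.
Qed.

(** The induction in [Fn_dia_wd] runs on sizes, so a size bound accompanies the weight bound when
    its hypothesis is extended bilinearly. *)
Lemma Fn_dia_ext N p q n m f g :
  (forall s t, alternating s -> alternating t -> (fs s + fs t < N)%N ->
     Fn (wt s + wt t) (B s ⋄ B t)) ->
  Fn p f -> Fn q g -> size_bounded n f -> size_bounded m g -> (n + m < N)%N ->
  Fn (p + q)%N (f ⋄ g).
Proof.
move=> FB fp gq fn gm lt_N; have hS := Fn_submodule (p + q)%N.
apply: (malg_submodule (L := fun f => f ⋄ g) hS); first exact: lin_bl (dia_bilin X kap) g.
move=> w wf; rewrite -wd_val.
apply: (malg_submodule (L := fun g => B (val w) ⋄ g) hS); first exact: lin_br (dia_bilin X kap) _.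
move=> w' wg; rewrite -wd_val; apply: Fn_le (FB _ _ (valP w) (valP w') _).
  by apply: leq_add; [apply: fp | apply: gq].
exact: leq_ltn_trans (leq_add (fn w wf) (gm w' wg)) lt_N.
Qed.

(** For letters the bound comes from [An_mul]. In the two context terms one bracket pair stays
    inside and one is added outside, which balances the two original pairs; the [kap]-term loses
    both. *)
Lemma Fn_dia_wd N s t : alternating s -> alternating t -> (fs s + fs t < N)%N ->
  Fn (wt s + wt t) (B s ⋄ B t).
Proof.
elim: N s t => // N IHN; case/lastP => [|u a] t alt_s alt_t lt_N.
  by rewrite dia_1l; apply: Fn_wd.
case: t alt_t lt_N => [|b v] alt_t lt_N.
  by rewrite dia_1r; apply: Fn_wd => //; rewrite leq_addr.
have wtua : wt (rcons u a) = (wt u + wt [:: a])%N by rewrite -cats1 weight_cat.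
have [alt_u alt_a] := alternating_rcons alt_s.
have [alt_b alt_v] := alternating_behead alt_t.
have [ab|ab] := eqVneq (is_br a) (is_br b); last first.
  by rewrite dia_concat //; apply: Fn_wd_junk; rewrite weight_cat.
rewrite fs_rcons (fs_cons b) in lt_N; rewrite wtua (wt_cons b).
have [_ FD FZ] := Fn_submodule (wt u + wt [:: a] + (wt [:: b] + wt v))%N.
move: (fs_gt0 a) (fs_gt0 b) => a0 b0.
case: a b ab alt_s alt_t alt_a alt_b a0 b0 lt_N {wtua} FD FZ => [x|x] [y|y] // _.
  move=> alt_s alt_t _ _ a0 b0 lt_N FD FZ; rewrite (dia_letters kap alt_s alt_t).
  apply: FD.
    apply: FZ; apply: Fn_le (IHN _ _ alt_u alt_v _); first by clear; lia.
    by slia.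
  rewrite big_seq_cond; apply: (submodule_sum _ (Fn_submodule _)) => z /andP[zc _].
  have Xz := coords_Xn (An_mul (An_letter x) (An_letter y)) zc.
  apply/FZ/Fn_wd_junk; move: (wt_lword Xz); rewrite !weight_cat.
  by clear; lia.
move=> alt_s alt_t alt_x alt_y a0 b0 lt_N FD FZ.
rewrite (dia_brackets kap alt_s alt_t).
have fsBr z : fs [:: Br z] = (fs z).+1 by rewrite forest_size_Br addn0.
rewrite !fsBr in lt_N; rewrite !weight_Br in FD FZ *.
have bsz z := @size_bounded_wd k A X _ z (leqnn (fs z)).
have IHxy : Fn (wt x + wt y) (B x ⋄ B y) by apply: IHN => //; slia.
have alt_bx : alternating [:: Br x] by rewrite alternating_Br.
have alt_by : alternating [:: Br y] by rewrite alternating_Br.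
apply: (FD); first apply: (FD).
- have Fxy : Fn (wt [:: Br x] + wt y) (P (B x) ⋄ B y).
    by rewrite brk_wd //; apply: IHN => //; rewrite fsBr; slia.
  apply: (Fn_le _ (@Fn_ctx u v _ _ (Fn_brk Fxy))); rewrite weight_Br.
  by clear; lia.
- have Fxy : Fn (wt x + wt [:: Br y]) (B x ⋄ P (B y)).
    by rewrite (brk_wd alt_y); apply: IHN => //; rewrite fsBr; slia.
  apply: (Fn_le _ (@Fn_ctx u v _ _ (Fn_brk Fxy))); rewrite weight_Br.
  by clear; lia.
apply: FZ.
have uxyB := size_bounded_dia (kap := kap) (bsz u) (size_bounded_dia (kap := kap) (bsz x) (bsz y)).
have uxyF : Fn (wt u + (wt x + wt y)) (B u ⋄ (B x ⋄ B y)).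
  apply: (Fn_dia_ext IHN _ IHxy (bsz u) (size_bounded_dia (kap := kap) (bsz x) (bsz y))).
    exact: Fn_wd.
  by slia.
have vF : Fn (wt v) (B v) by apply: Fn_wd.
apply: (Fn_le _ (Fn_dia_ext IHN uxyF vF uxyB (bsz v) _)); last by slia.
by clear; lia.
Qed.

Lemma Fn_dia p q f g : Fn p f -> Fn q g -> Fn (p + q)%N (f ⋄ g).
Proof.
move=> fp gq; have hS := Fn_submodule (p + q)%N.
apply: (malg_submodule (L := fun f => f ⋄ g) hS); first exact: lin_bl (dia_bilin X kap) g.
move=> w wf; rewrite -wd_val.
apply: (malg_submodule (L := fun g => B (val w) ⋄ g) hS); first exact: lin_br (dia_bilin X kap) _.
move=> w' wg; rewrite -wd_val; apply: Fn_le (Fn_dia_wd (valP w) (valP w') (ltnSn _)).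
by apply: leq_add; [apply: fp | apply: gq].
Qed.

Lemma Fn_exhaustive : \bigcup_n Fn n = [set: F].
Proof.
apply/seteqP; split=> // f _; exists (\max_(w <- msupp f) wt (val w)) => // w wf.
exact: (leq_bigmax_seq (F := fun w : word (letter X) => wt (val w)) w wf isT).
Qed.

Lemma Fn0 : Fn 0 = [set a *: B [::] | a in [set: k]].
Proof.
apply/seteqP; split=> [f f0|_ [a _ <-]]; last first.
  by have [_ _ FZ] := Fn_submodule 0; apply/FZ/Fn_wd.
exists (f@_(mkword [::])) => //; rewrite [RHS](malg_basisE f).
have w0 w : w \in msupp f -> w = mkword [::].
  move=> /f0; rewrite leqn0 => /eqP/wt_eq0 w0.
  by apply: val_inj; rewrite mkwordK.
have sub : (msupp f `<=` [fset (mkword [::] : word (letter X))])%fset.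
  by apply/fsubsetP => w /w0 ->; rewrite in_fset1.
have := lin_extEw (fun w => << w >> : F) sub.
by rewrite /lin_ext big_seq_fset1 => ->; rewrite -wdE.
Qed.

End WordFiltration.

(** * The connected filtered bialgebra F(A) *)

Section FreeBialgebra.
Context {k : comNzRingType} {A : algType k} {lam : k} {X : set A}.
Context {DeltaA : A -> A ⊗ A} {epsA : A -> k^o} {An Xn : nat -> set A}.
Hypothesis hA : is_connected_filtered_bialgebra *%R 1 DeltaA epsA An.
Hypothesis hX : is_filtered_basis 1 epsA An X Xn.
Local Notation F := (FA X).
Local Notation one := (wd [::] : F).
Local Notation mul := (@dia k A X (- lam ^+ 2)).
Context {epsM : F -> k^o} {DeltaM : F -> F ⊗ F}.
Hypothesis eps_hom : is_alg_hom mul one *%R (1 : k^o) epsM.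
Hypothesis eps_brk : forall f, epsM (brk f) = - lam *: epsM f.
Hypothesis eps_jA : forall a, epsM (jA X a) = epsA a.
Hypothesis Delta_hom : is_alg_hom mul one (tensor_mul mul mul) (tens one one) DeltaM.
Hypothesis Delta_brk : forall f, DeltaM (brk f) = tensor_lift (fun u v =>
  tens (brk u + lam *: u) (epsM v *: one) + tens u (brk v)) (DeltaM f).
Hypothesis Delta_jA : forall a, DeltaM (jA X a) = tensor_map (jA X) (jA X) (DeltaA a).

Let X_basis := fbasis_basis hX.
Let XnE := fbasis_exhaustive hX.
Let Xn_incr := fbasis_increasing hX.
Let An_span := fbasis_span hX.
Let Xn0 := fbasis_0 hX.
Let hAf := proj1 hA.
Let An_mul := filt_mul hAf.
Let coalgA := bialg_coalgebra (filt_bialgebra hAf).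

Lemma basis1 : X 1.
Proof. by rewrite XnE; exists 0%N => //; rewrite Xn0. Qed.

Local Notation FnX := (@Fn k A X Xn).
Local Notation wt := (weight (fun l : letter X => letter_deg Xn (val l))).
Let hFn := @Fn_submodule k A X Xn.
Let brkL := @brk_linear k A X.
Let jAL := jA_linear X_basis.

Lemma dia_is_algebra : is_algebra mul one.
Proof.
split.
- exact: dia_bilin.
- exact: dia_assoc X_basis basis1.
- exact: dia_1l.
- exact: dia_1r.
Qed.

Lemma free_is_coalgebra : is_coalgebra DeltaM epsM.
Proof.
apply: (generated_is_coalgebra coalgA dia_is_algebra brkL jAL eps_hom
  eps_brk eps_jA Delta_hom Delta_brk Delta_jA).
exact: F_gen_ind X_basis basis1.
Qed.

Lemma free_is_bialgebra : is_bialgebra mul one DeltaM epsM.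
Proof.
by split=> //; [exact: dia_is_algebra | exact: free_is_coalgebra].
Qed.

Lemma DeltaM_brk f :
  DeltaM (brk f) = tens (brk f + lam *: f) one + tensor_map id (@brk k A X) (DeltaM f).
Proof.
apply: (Delta_P_split brkL eps_hom Delta_brk).
exact: coalg_counitr free_is_coalgebra f.
Qed.

(** Induction on words. Letters use the filtration of [A]. For a bracket, [DeltaM_brk] gives a
    tensor with right factor in step 0 and a part whose right factors are bracketed; both fit in one
    degree more. Longer words are products. *)
Lemma free_filt_Delta n f : FnX n f -> tensor_filtration FnX n (DeltaM f).
Proof.
have TS m := @tensor_filtration_submodule k F FnX m.
have DL := hom_linear Delta_hom.
have wt0 : FnX 0%N one by apply: Fn_wd.
(* The difference of the two indices is absorbed by the right factor. *)
have TFle m m' t : (m <= m')%N -> tensor_filtration FnX m t -> tensor_filtration FnX m' t.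
  move=> le_m; apply: span_ind => // _ [p [q [a [b [pq pa qb ->]]]]].
  rewrite -(subnKC le_m) -pq -addnA; apply: tensor_filtration_tens => //.
  by apply: (Fn_le _ qb); apply: leq_addr.
have Dw : forall s, alternating s ->
    tensor_filtration FnX (wt s) (DeltaM (wd s)).
  apply: alternating_ind => [|l|s alt_s Ds|a s alt_as Da Ds].
  - by rewrite (hom_one Delta_hom); apply: (tensor_filtration_tens wt0 wt0).
  - rewrite -(jA_letter X_basis) Delta_jA.
    have An_l := An_letter Xn_incr XnE An_span l.
    have FjA m a : An m a -> FnX (m + 0)%N (jA X a).
      by rewrite addn0; apply: Fn_jA.
    have := tensor_filtration_map jAL jAL FjA FjA (filt_Delta hAf An_l).
    by rewrite !addn0.
  - have alt_Bs : alternating [:: Br s] by rewrite alternating_Br.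
    rewrite -(brk_wd alt_s) weight_Br DeltaM_brk; have [_ TD _] := TS (wt s).+1.
    have Fs : FnX (wt s) (wd s) by apply: Fn_wd.
    apply: TD.
      rewrite -[X in tensor_filtration _ X]addn0; apply: tensor_filtration_tens wt0.
      have [_ FD FZ] := hFn (wt s).+1.
      apply: FD; first exact: Fn_brk.
      by apply: FZ; apply: (Fn_le _ Fs).
    have Fid m x : FnX m x -> FnX (m + 0)%N (id x) by rewrite addn0.
    have Fbrk m x : FnX m x -> FnX (m + 1)%N (brk x) by rewrite addn1; apply: Fn_brk.
    have := tensor_filtration_map (@lin_id k F) brkL Fid Fbrk Ds.
    by rewrite add0n addn1.
  rewrite (dia_cons (- lam ^+ 2) alt_as) (hom_mul Delta_hom) wt_cons.
  apply: tensor_filtration_mul Da Ds; first exact: dia_bilin.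
  by move=> p q x y; apply: Fn_dia.
apply: (Fn_lin (TS n) DL) => s alt_s sn; exact: TFle sn (Dw s alt_s).
Qed.

Lemma free_is_connected_filtered :
  is_connected_filtered_bialgebra mul one DeltaM epsM FnX.
Proof.
split; split.
- exact: free_is_bialgebra.
- exact: hFn.
- by move=> n; apply: Fn_le.
- exact: Fn_exhaustive.
- by move=> p q x y; apply: Fn_dia.
- exact: free_filt_Delta.
- exact: Fn0.
(* Subtracting the counit times the unit leaves an element of the kernel, because [epsM] sends the
   unit to 1. *)
- move=> x; exists (epsM x *: one), (x - epsM x *: one); split.
  + by rewrite Fn0 //; exists (epsM x).
  + rewrite (linD (hom_linear eps_hom)) -scaleN1r !(linZ (hom_linear eps_hom)).
    by rewrite (hom_one eps_hom) [_ *: 1]mulr1 scaleN1r subrr.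
  + by rewrite addrC subrK.
- move=> x; rewrite Fn0 // => -[a _ <-]; rewrite (linZ (hom_linear eps_hom)).
  by rewrite (hom_one eps_hom) [_ *: 1]mulr1 => ->; rewrite scale0r.
Qed.

End FreeBialgebra.

Theorem theorem3p13 (k : comNzRingType) (lam : k) (A : algType k)
    (DeltaA : A -> A ⊗ A) (epsA : A -> k^o) (An : nat -> set A)
    (X : set A) (Xn : nat -> set A)
    (hA : is_connected_filtered_bialgebra *%R 1 DeltaA epsA An)
    (hX : is_filtered_basis 1 epsA An X Xn)
    (epsM : FA X -> k^o) (DeltaM : FA X -> FA X ⊗ FA X)
    (hepsM : is_mrb_morphism (diamond (- lam ^+ 2)) (F1 X) (@P_A k A X)
               *%R (1 : k^o) (fun c : k^o => - lam *: c) epsM)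
    (hepsMj : forall a, epsM (j_A X a) = epsA a)
    (hDeltaM : is_mrb_morphism (diamond (- lam ^+ 2)) (F1 X) (@P_A k A X)
                 (tensor_mul (diamond (- lam ^+ 2)) (diamond (- lam ^+ 2))) (tens (F1 X) (F1 X)) (Q_op lam epsM) DeltaM)
    (hDeltaMj : forall a,
       DeltaM (j_A X a) = tensor_map (j_A X) (j_A X) (DeltaA a)) :
  (exists Fn : nat -> set (FA X),
     is_connected_filtered_bialgebra (diamond (- lam ^+ 2)) (F1 X) DeltaM epsM Fn) /\
  is_hopf_algebra (diamond (- lam ^+ 2)) (F1 X) DeltaM epsM.
Proof.
have [eps_hom eps_brk] := hepsM; have [Delta_hom Delta_brk] := hDeltaM.
(* The locked constants replace the original ones, so that the preceding results apply. *)
rewrite /Q_op in Delta_brk; rewrite !diaE !F1E !brkE !jAE in eps_hom eps_brk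
  Delta_hom Delta_brk hepsMj hDeltaMj *.
have cf := free_is_connected_filtered hA hX eps_hom eps_brk hepsMj Delta_hom
  Delta_brk hDeltaMj.
split; first by exists (@Fn k A X Xn).
split; first exact: (filt_bialgebra (proj1 cf)).
by eexists; apply: (connected_filtered_antipode cf).
Qed.
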